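(* Let $f:\mathbb{R}^n\to\mathbb{R}\cup\{+\infty\}$ be three times continuously differentiable on $\mathrm{dom}(f)$, bounded below, and $F$-based $\kappa$-self-concordant for some $\kappa>0$, where $F:\mathbb{R}^n\to\mathbb{R}\cup\{+\infty\}$ is strictly convex and $\kappa_F$-self-concordant for some $\kappa_F>0$. Consider the Adaptive Regularization Method (ARM) with Option 2 and tolerances $\epsilon_g,\epsilon_H>0$. Then $\sigma_j\le\max(\sigma_0,\gamma_3)$ for all iterations $j$, and ARM with Option 2 terminates within at most $O(\epsilon_g^{-2}+\epsilon_H^{-1.5})$ iterations.
   Context: Notation: $\mathrm{dom}(f)=\{x\in\mathbb{R}^n: f(x)<+\infty\}$; $\nabla^2 f(x)[h,h]=h^\top\nabla^2 f(x)h$, and $\nabla^3 f(x)[h,h,h]$ is the third directional derivative of $f$ at $x$ along $h$. $\lambda_{\min}$ is the smallest eigenvalue; $A^{+}$ is the Moore–Penrose pseudoinverse. For $\kappa>0$, a closed convex function $g:\mathbb{R}^n\to\mathbb{R}\cup\{+\infty\}$ is $\kappa$-self-concordant if $\mathrm{dom}(g)$ is open, $g$ is three times continuously differentiable on $\mathrm{dom}(g)$, and $\nabla^3 g(x)[h,h,h]\le 2\kappa(\nabla^2 g(x)[h,h])^{3/2}$ for all $x\in\mathrm{dom}(g)$, $h\in\mathbb{R}^n$. Given $F:\mathbb{R}^n\to\mathbb{R}\cup\{+\infty\}$, the function $f$ is $F$-based $\kappa$-self-concordant if $\mathrm{dom}(f)\subseteq\mathrm{dom}(F)$, $g=f+F$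 is $\kappa$-self-concordant, and $\nabla^2 g(x)\succ0$ for all $x\in\mathrm{dom}(f)$. Define $\omega(z)=z-\log(1+z)$ for $z\ge0$, and $\omega_\star(z)=-z-\log(1-z)$ if $0\le z<1$, $\omega_\star(z)=+\infty$ if $z\ge 1$ (including $z=+\infty$). Conventions: $\sqrt{x}=+\infty$ for $x<0$; $0\cdot\infty=0$; $\frac00=0$. For $\sigma>0$ and $x\in\mathrm{dom}(f)$, $\nu_{f,\sigma F}(x)=\sqrt{d^\top\nabla^2(f+\sigma F)(x)d}$ with $d=-(\nabla^2(f+\sigma F)(x))^{+}\nabla f(x)$. ARM with Option 2. Parameters: $0<\sigma_{\min}\le\sigma_0$, $0<\eta_1\le\eta_2<1$, $0<\gamma_1<1<\gamma_2<\gamma_3$, tolerances $\epsilon_g,\epsilon_H>0$, initial point $x_0\in\mathrm{dom}(f)$. For $j=0,1,2,\dots$: (1) Compute $v_j$ with $\|v_j\|=1$ and $\nabla^2f(x_j)v_j=\lambda_{\min}(\nabla^2f(x_j))v_j$, and set $\lambda_{\mathrm{nc}}=\sigma_j\sqrt{\epsilon_H}\,v_j^\top\nabla^2F(x_j)v_j$. Set $d_j=-(\nabla^2(f+\sigma_jF)(x_j))^{+}\nabla f(x_j)$ if $\lambda_{\min}(\nabla^2f(x_j))\ge-\lambda_{\mathrm{nc}}$; $d_j=v_j$ if $\lambda_{\min}(\nabla^2f(x_j))<-\lambda_{\mathrm{nc}}$ and $\nabla f(x_j)^\top v_j\le0$; $d_j=-v_j$ otherwise. Let $\rho_j=-\nabla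 f(x_j)^\top d_j$, $\delta_j=d_j^\top\nabla^2f(x_j)d_j$, $\Delta_j=d_j^\top\nabla^2F(x_j)d_j$. For $t\ge0$ let $$m_j(t)=f(x_j)-t\,\nu_{f,\sigma_jF}(x_j)^2+\kappa^{-2}\omega_\star(\kappa t\,\nu_{f,\sigma_jF}(x_j))\quad\text{if }\lambda_{\min}(\nabla^2f(x_j))\ge-\lambda_{\mathrm{nc}},$$ $$m_j(t)=f(x_j)-\kappa_F^{-2}\omega(\kappa_Ft\sqrt{\sigma_j\Delta_j})+\kappa^{-2}\omega_\star(\kappa t\sqrt{\delta_j+\sigma_j\Delta_j})\quad\text{otherwise.}$$ Stop and return $x_j$ if $\nu_{f,\sigma_jF}(x_j)\le\epsilon_g$ and $\lambda_{\min}(\nabla^2f(x_j))\ge-\lambda_{\mathrm{nc}}$. (2) Set $t_j=\arg\min_{t\ge0}m_j(t)$, with $t_j=0$ if this would give $t_j=\infty$, if the minimizer is not unique, or if $\delta_j+\sigma_j\Delta_j\le0$; when $t_j=0$, $m_j(t_j)=f(x_j)$. (3) Set $r_j=\frac{f(x_j)-f(x_j+t_jd_j)}{f(x_j)-m_j(t_j)}$, where $f(x_j+t_jd_j)=+\infty$ if $x_j+t_jd_j\notin\mathrm{dom}(f)$. Set $x_{j+1}=x_j+t_jd_j$ if $r_j>\eta_1$ and $x_{j+1}=x_j$ otherwise. Choose any $\sigma_{j+1}\in[\max(\sigma_{\min},\gamma_1\sigma_j),\sigma_j]$ if $r_j\ge\eta_2$; any $\sigma_{j+1}\in[\sigma_j,\gamma_2\sigma_j]$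 if $r_j\in(\eta_1,\eta_2)$; any $\sigma_{j+1}\in[\gamma_2\sigma_j,\gamma_3\sigma_j]$ if $r_j\le\eta_1$. The $O(\cdot)$ is as $\epsilon_g,\epsilon_H\to0$, with hidden constant independent of $\epsilon_g,\epsilon_H$ (the functions, initial point and other algorithm parameters being fixed). *)

(* Defs.v *)
(* Mathematical Components with MathComp-Analysis. *)
From HB Require Import structures.
From mathcomp Require Import all_boot all_order all_algebra.
From mathcomp Require Import all_classical all_reals all_analysis.
Set Implicit Arguments.
Unset Strict Implicit.
Unset Printing Implicit Defensive.
Import Order.TTheory GRing.Theory Num.Theory.
Import numFieldNormedType.Exports.
Local Open Scope classical_set_scope.
Local Open Scope ring_scope.

Section linear_algebra.
Context {R : realType} {n : nat}.
Implicit Types (A : 'M[R]_n) (u v : 'cV[R]_n).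

Definition dotc u v : R := (u^T *m v) 0 0.

(* The norm `|v| that the library puts on matrices is the sup norm. *)
Definition enorm v : R := Num.sqrt (dotc v v).

Definition quad A v : R := (v^T *m A *m v) 0 0.

Definition pos_def A := forall v, v != 0 -> 0 < quad A v.

Definition is_pinv A B :=
  [/\ A *m B *m A = A, B *m A *m B = B,
      (A *m B)^T = A *m B & (B *m A)^T = B *m A].

Definition pinv A : 'M[R]_n := xget 0 [set B | is_pinv A B].

(* A real symmetric matrix of positive size has a least eigenvalue, so the
   default value 0 plays no role for Hessians. *)
Definition lambda_min A : R :=
  xget 0 [set a | eigenvalue A a /\ forall b, eigenvalue A b -> a <= b].

End linear_algebra.

Section extended_functions.
Context {R : realType} {n : nat}.
Implicit Types (f g : 'cV[R]_n -> \bar R) (h : 'cV[R]_n -> R).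

Definition dom f : set 'cV[R]_n := [set x | (f x < +oo)%E].

Definition epigraph g : set ('cV[R]_n * R^o)%type :=
  [set p | (g p.1 <= p.2%:E)%E].

Definition closed_convex g :=
  closed (epigraph g) /\
  convex_set (epigraph g : set (convex_lmodType ('cV[R]_n * R^o)%type)).

Definition strictly_convex f :=
  forall x y (t : R), dom f x -> dom f y -> x != y -> 0 < t < 1 ->
    (f (t *: x + (1 - t) *: y)%R < t%:E * f x + (1 - t)%:E * f y)%E.

(* k times continuously differentiable on an open set U: in finite dimension,
   continuity of x |-> 'D_v h x for every v is continuity of the differential. *)
Fixpoint Ck_on (k : nat) (U : set 'cV[R]_n) h : Prop :=
  if k is k'.+1 then
    (forall x, U x -> differentiable h x) /\
    (forall v, Ck_on k' U (fun x => 'D_v h x))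
  else forall x, U x -> {for x, continuous h}.

(* The differential operators below are applied at points of dom f, in all uses
   an open set on which f coincides with the real-valued function fine \o f. *)
Definition Ck_dom (k : nat) f := Ck_on k (dom f) (fine \o f).

Definition grad f (x : 'cV[R]_n) : 'cV[R]_n :=
  \col_i 'D_(delta_mx i 0) (fine \o f) x.

Definition hess f (x : 'cV[R]_n) : 'M[R]_n :=
  \matrix_(i, j) 'D_(delta_mx i 0) ('D_(delta_mx j 0) (fine \o f)) x.

Definition third f (x d : 'cV[R]_n) : R := 'D_d ('D_d ('D_d (fine \o f))) x.

Definition self_concordant (k : R) g :=
  [/\ closed_convex g, open (dom g), Ck_dom 3 g &
      forall x d, dom g x ->
        third g x d <= 2 * k * quad (hess g x) d `^ (3 / 2)].

Definition based_self_concordant F (k : R) f :=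
  let g := fun x => (f x + F x)%E in
  [/\ dom f `<=` dom F, self_concordant k g &
      forall x, dom f x -> pos_def (hess g x)].

End extended_functions.

Section scalar_functions.
Context {R : realType}.

Definition omega (z : R) : R := z - ln (1 + z).

Definition omega_star (z : \bar R) : \bar R :=
  if z is z'%:E then if z' < 1 then (- z' - ln (1 - z'))%:E else +oo%E
  else +oo%E.

(* Unlike Num.sqrt and sqrte, +oo on negative numbers. *)
Definition esqrt (x : R) : \bar R :=
  if x < 0 then +oo%E else (Num.sqrt x)%:E.

Definition minimizer (m : R -> \bar R) (t : R) :=
  0 <= t /\ forall u, 0 <= u -> (m t <= m u)%E.

(* 0 when m has no minimizer on [0, +oo[ or more than one. *)
Definition argmin0 (m : R -> \bar R) : R :=
  xget 0 [set t | minimizer m t /\ forall u, minimizer m u -> u = t].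

End scalar_functions.

Record arm_params (R : realType) := ArmParams {
  sigma_min : R; sigma0 : R;
  eta1 : R; eta2 : R;
  gamma1 : R; gamma2 : R; gamma3 : R }.

Definition arm_params_ok (R : realType) (p : arm_params R) :=
  [/\ 0 < sigma_min p <= sigma0 p,
      0 < eta1 p /\ eta1 p <= eta2 p < 1 &
      0 < gamma1 p < 1 /\ 1 < gamma2 p < gamma3 p].

Section arm.
Context {R : realType} {n : nat}.
Variables (f F : 'cV[R]_n -> \bar R) (k kF : R) (p : arm_params R).
Variables (eg eH : R).
Implicit Types (x d v : 'cV[R]_n) (s t : R).

Definition regularized s : 'cV[R]_n -> \bar R := fun y => (f y + s%:E * F y)%E.

Definition newton_dir x s : 'cV[R]_n :=
  - (pinv (hess (regularized s) x) *m grad f x).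

Definition nu x s : \bar R :=
  esqrt (quad (hess (regularized s) x) (newton_dir x s)).

Definition unit_min_eigenvector x v :=
  enorm v = 1 /\ hess f x *m v = lambda_min (hess f x) *: v.

Definition lambda_nc x s v : R := s * Num.sqrt eH * quad (hess F x) v.

Definition newton_case x s v : bool :=
  - lambda_nc x s v <= lambda_min (hess f x).

Definition arm_dir x s v : 'cV[R]_n :=
  if newton_case x s v then newton_dir x s
  else if dotc (grad f x) v <= 0 then v else - v.

Definition arm_delta x s v : R := quad (hess f x) (arm_dir x s v).

Definition arm_Delta x s v : R := quad (hess F x) (arm_dir x s v).

(* In \bar R, 0 * +oo = 0, hence arm_model x s v 0 = f x whenever x is in
   dom f.  If t > 0 and one of the square roots below is +oo, then
   arm_delta + s * arm_Delta < 0, in which case arm_steplength ignores the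
   model.  The argument of Num.sqrt is nonnegative, F being convex. *)
Definition arm_model x s v t : \bar R :=
  (if newton_case x s v then
     f x - t%:E * nu x s ^+ 2
     + (k ^- 2)%:E * omega_star (k%:E * t%:E * nu x s)
   else
     f x - (kF ^- 2 * omega (kF * t * Num.sqrt (s * arm_Delta x s v)))%:E
     + (k ^- 2)%:E *
         omega_star (k%:E * t%:E *
                     esqrt (arm_delta x s v + s * arm_Delta x s v)%R))%E.

Definition arm_stop x s v := (nu x s <= eg%:E)%E /\ newton_case x s v.

Definition arm_steplength x s v : R :=
  if 0 < arm_delta x s v + s * arm_Delta x s v
  then argmin0 (arm_model x s v) else 0.

Definition arm_trial x s v : 'cV[R]_n :=
  x + arm_steplength x s v *: arm_dir x s v.

(* 0 / 0 = 0 in \bar R. *)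
Definition arm_ratio x s v : \bar R :=
  ((f x - f (arm_trial x s v)) /
   (f x - arm_model x s v (arm_steplength x s v)))%E.

Definition arm_next x s v : 'cV[R]_n :=
  if ((eta1 p)%:E < arm_ratio x s v)%E then arm_trial x s v else x.

Definition arm_sigma_update (r : \bar R) s s' :=
  [/\ ((eta2 p)%:E <= r)%E -> Num.max (sigma_min p) (gamma1 p * s) <= s' <= s,
      ((eta1 p)%:E < r < (eta2 p)%:E)%E -> s <= s' <= gamma2 p * s &
      (r <= (eta1 p)%:E)%E -> gamma2 p * s <= s' <= gamma3 p * s].

Implicit Types (xs vs : nat -> 'cV[R]_n) (ss : nat -> R).

(* Iteration j is performed: the method has not returned before it. *)
Definition arm_reached xs ss vs (j : nat) :=
  forall i, (i < j)%N -> ~ arm_stop (xs i) (ss i) (vs i).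

(* The values of the sequences after the method has returned are arbitrary. *)
Definition arm_run (x0 : 'cV[R]_n) xs ss vs :=
  [/\ xs 0%N = x0, ss 0%N = sigma0 p &
      forall j, arm_reached xs ss vs j ->
        unit_min_eigenvector (xs j) (vs j) /\
        (~ arm_stop (xs j) (ss j) (vs j) ->
           xs j.+1 = arm_next (xs j) (ss j) (vs j) /\
           arm_sigma_update (arm_ratio (xs j) (ss j) (vs j))
             (ss j) (ss j.+1))].

End arm.

(* Main.v *)
Require Import Defs.
From mathcomp Require Import all_boot all_order all_algebra.
From mathcomp Require Import all_classical all_reals all_analysis.
From mathcomp Require Import ring lra.
Import Order.TTheory GRing.Theory Num.Theory.
Import numFieldNormedType.Exports.
Local Open Scope classical_set_scope.
Local Open Scope ring_scope.

Set Implicit Arguments.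
Unset Strict Implicit.
Unset Printing Implicit Defensive.

(** Write [g = f + F] and let [d] be the direction of an
iteration at [x].  Self-concordance of [g] bounds [g (x + t d)] from above by
its first-order expansion plus [k^-2 omega_star (k t |d|_g)], and
self-concordance of [F] bounds [F (x + t d)] from below by its expansion plus
[kF^-2 omega (kF t |d|_F)]; the difference bounds [f (x + t d)] from above
([based_sc_descent]).  For [sigma >= 1] this upper bound lies below the model
of the iteration, for both kinds of direction.  Hence [sigma >= 1] forces the
ratio to be at least 1, the iteration succeeds and sigma does not grow; below
1, sigma can grow by a factor [gamma3] at most, which gives
[max (sigma0, gamma3)].

Every trial step with a positive length promises a decrease of the model that is
bounded below independently of the iterate.  In the Newton case the minimum of the model
is [f x - k^-2 omega (k nu)], and [nu > eg] makes this a decrease of order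
[eg^2].  In the negative curvature case, write [a = sqrt (s Delta)] and
[b = sqrt (delta + s Delta)], so that the relative gap
[(a^2 - b^2) / a^2] exceeds [sqrt eH]; the model only depends on [a t] and
[b / a], and a step [t] proportional to the relative gap already decreases it
by the cube of that gap ([curvature_gap_le]).  A step of length zero has
ratio 0 and occurs for [sigma < 1] only ([arm_iteration_progress]).

Counting uses one potential function: [ln sigma / ln gamma2] rises by at least
1 at each failure, and falls at each success by at most
[ln (1 / gamma1) / ln gamma2], which a suitable multiple of the decrease of
[f], divided by the guaranteed gain, compensates with 1 to spare
([arm_reached_bound]). *)

(** * Monotonicity and bounds for omega *)

Section scalar_calculus.
Context {R : realType}.
Implicit Types (x y z c : R).

Lemma le_of_derive_le0 (h dh : R -> R) (a b : R) : a <= b ->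
  (forall x, a <= x <= b -> is_derive x 1 h (dh x)) ->
  (forall x, a <= x <= b -> dh x <= 0) -> h b <= h a.
Proof.
move=> ab hd dh0.
have hd' x : x \in `]a, b[ -> is_derive x 1 h (dh x).
  by rewrite in_itv => /andP[ax xb]; apply: hd; rewrite !ltW.
have hc : {within `[a, b], continuous h}.
  apply: derivable_within_continuous => x.
  by rewrite in_itv => /hd /@ex_derive.
have [x xab E] := MVT_segment ab hd' hc.
rewrite -subr_le0 E mulr_le0_ge0 ?subr_ge0//.
by apply: dh0; move: xab; rewrite in_itv.
Qed.

Lemma lt_of_derive_lt0 (h dh : R -> R) (a b : R) : a < b ->
  (forall x, a <= x <= b -> is_derive x 1 h (dh x)) ->
  (forall x, a < x < b -> dh x < 0) -> h b < h a.
Proof.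
move=> ab hd dh0.
have hd' x : x \in `]a, b[ -> is_derive x 1 h (dh x).
  by rewrite in_itv => /andP[ax xb]; apply: hd; rewrite !ltW.
have hc : {within `[a, b], continuous h}.
  apply: derivable_within_continuous => x.
  by rewrite in_itv => /hd /@ex_derive.
have [x xab E] := MVT ab hd' hc.
rewrite -subr_lt0 E nmulr_rlt0 ?subr_gt0//.
by apply: dh0; move: xab; rewrite in_itv.
Qed.

Lemma lt_of_derive_gt0 (h dh : R -> R) (a b : R) : a < b ->
  (forall x, a <= x <= b -> is_derive x 1 h (dh x)) ->
  (forall x, a < x < b -> 0 < dh x) -> h a < h b.
Proof.
move=> ab hd dh0; rewrite -ltrN2.
apply: (@lt_of_derive_lt0 (fun x => - h x) (fun x => - dh x)) => // x xab.
  by have := hd _ xab => ?; exact: is_deriveN.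
by rewrite oppr_lt0 dh0.
Qed.

Lemma le0_of_derive2_le0 (h dh ddh : R -> R) (t : R) : 0 <= t ->
  h 0 = 0 -> dh 0 = 0 ->
  (forall x, 0 <= x <= t -> is_derive x 1 h (dh x)) ->
  (forall x, 0 <= x <= t -> is_derive x 1 dh (ddh x)) ->
  (forall x, 0 <= x <= t -> ddh x <= 0) -> h t <= 0.
Proof.
move=> t0 h0 dh0 hd dhd ddh0.
rewrite -[leRHS]h0; apply: (le_of_derive_le0 t0 hd) => x /andP[x0 xt].
rewrite -[leRHS]dh0; apply: (@le_of_derive_le0 dh ddh) => // y /andP[y0 yx].
  by apply: dhd; rewrite y0 (le_trans yx).
by apply: ddh0; rewrite y0 (le_trans yx).
Qed.

Lemma is_derive_omega x : - 1 < x -> is_derive x 1 (@omega R) (x / (1 + x)).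
Proof.
move=> x1; have x1' : 0 < 1 + x by lra.
have D : is_derive x 1 (fun z : R => 1 + z) 1.
  by rewrite -[X in is_derive _ _ _ X]add0r; exact: is_deriveD.
have L :=
  @is_derive1_comp _ (@ln R) (fun z => 1 + z) x _ _ (is_derive1_ln x1') D.
have -> : x / (1 + x) = 1 - (1 + x)^-1 * 1 by field; rewrite gt_eqF.
exact: is_deriveB.
Qed.

Lemma is_derive_omega_scaled c x : - 1 < c * x ->
  is_derive x 1 (fun y => omega (c * y)) (c ^+ 2 * x / (1 + c * x)).
Proof.
move=> cx; have D : is_derive x 1 (fun y : R => c * y) c.
  by apply: is_derive_eq; rewrite /GRing.scale /=; ring.
have := @is_derive1_comp _ (@omega R) (fun y => c * y) x _ _ (is_derive_omega cx) D.
have -> : c ^+ 2 * x / (1 + c * x) = c * x / (1 + c * x) * c.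
  by rewrite expr2; ring.
by [].
Qed.

(** Up to a factor, [y / (1 + c y)] is the derivative of [omega (c y)], so this is
the second derivative of the self-concordant comparison functions. *)
Lemma is_derive_slope c x : - 1 < c * x ->
  is_derive x 1 (fun y : R => y / (1 + c * y)) ((1 + c * x) ^- 2).
Proof.
move=> cx; have c1 : 1 + c * x != 0 by rewrite gt_eqF//; lra.
have D : is_derive x 1 (fun y : R => 1 + c * y) c.
  by apply: is_derive_eq; rewrite /GRing.scale /=; ring.
have V := @is_deriveV _ (fun y => 1 + c * y) x _ _ c1 D.
by apply: is_derive_eq; rewrite /GRing.scale /=; field.
Qed.

Lemma omega0 : omega 0 = 0 :> R.
Proof. by rewrite /omega addr0 ln1 subrr. Qed.

(** [omega z - z^2 / 2] has derivative [- z^2 / (1 + z)].  Negative arguments are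
allowed because [omega_star z = omega (- z)]; the same inequality thus bounds
increments of [omega] from above and increments of [omega_star] from below. *)
Lemma omega_sub_square_nincr x y : - 1 < x -> x <= y ->
  omega y - omega x <= (y ^+ 2 - x ^+ 2) / 2.
Proof.
move=> x1 xy.
suff : omega y - y ^+ 2 / 2 <= omega x - x ^+ 2 / 2 by lra.
apply: (@le_of_derive_le0 (fun z => omega z - z ^+ 2 / 2)
  (fun z => - z ^+ 2 / (1 + z)) x y xy) => z /andP[xz zy].
  have D := @is_derive_omega z (lt_le_trans x1 xz).
  apply: is_derive_eq; rewrite /GRing.scale /=; field; lra.
by rewrite mulNr oppr_le0 divr_ge0 ?sqr_ge0//; lra.
Qed.

Lemma omegaN_le x y : 0 <= x <= y -> y < 1 -> omega (- x) <= omega (- y).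
Proof.
move=> /andP[x0 xy] y1; rewrite -subr_le0.
have H : omega (- x) - omega (- y) <= ((- x) ^+ 2 - (- y) ^+ 2) / 2.
  by apply: omega_sub_square_nincr; rewrite ?ltrN2 ?lerN2.
apply: le_trans H _; rewrite !sqrrN ler_pdivrMr// mul0r subr_le0.
by apply: lerXn2r; rewrite ?nnegrE// (le_trans x0).
Qed.

Lemma omega_ge_cubic x : 0 <= x -> x ^+ 2 / 2 - x ^+ 3 / 3 <= omega x.
Proof.
move=> x0.
suff : x ^+ 2 / 2 - x ^+ 3 / 3 - omega x <=
       0 ^+ 2 / 2 - 0 ^+ 3 / 3 - omega 0 by rewrite omega0; lra.
apply: (@le_of_derive_le0 (fun z => z ^+ 2 / 2 - z ^+ 3 / 3 - omega z)
  (fun z => - (z ^+ 3 / (1 + z))) 0 x x0) => z /andP[z0 zx].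
  have z1 : -1 < z by lra.
  have D := is_derive_omega z1.
  apply: is_derive_eq; rewrite /GRing.scale /=; field; lra.
by rewrite oppr_le0 divr_ge0 ?exprn_ge0//; lra.
Qed.

Lemma omegaN_le_cubic x : 0 <= x <= 2^-1 ->
  omega (- x) <= x ^+ 2 / 2 + 2 * x ^+ 3 / 3.
Proof.
move=> /andP[x0 xh].
suff : omega (-1 * x) - x ^+ 2 / 2 - 2 * x ^+ 3 / 3 <=
       omega (-1 * 0) - 0 ^+ 2 / 2 - 2 * 0 ^+ 3 / 3.
  by rewrite mulN1r mulr0 omega0; lra.
apply: (@le_of_derive_le0 (fun z => omega (-1 * z) - z ^+ 2 / 2 - 2 * z ^+ 3 / 3)
  (fun z => - (z ^+ 2 * (1 - 2 * z) / (1 - z))) 0 x x0) => z /andP[z0 zx].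
  have z1 : -1 < -1 * z by lra.
  have D := is_derive_omega_scaled z1.
  apply: is_derive_eq; rewrite /GRing.scale /=; field; lra.
rewrite oppr_le0 divr_ge0 ?mulr_ge0 ?exprn_ge0//; lra.
Qed.

Lemma omega_ge_quadratic x : 0 <= x -> x ^+ 2 / (2 * (1 + x)) <= omega x.
Proof.
move=> x0.
suff : x ^+ 2 / (2 * (1 + x)) - omega x <= 0 ^+ 2 / (2 * (1 + 0)) - omega 0.
  by rewrite omega0; lra.
apply: (@le_of_derive_le0 (fun z => z ^+ 2 / (2 * (1 + z)) - omega z)
  (fun z => - (z ^+ 2 / (2 * (1 + z) ^+ 2))) 0 x x0) => z /andP[z0 zx].
  have z1 : -1 < z by lra.
  have D := is_derive_omega z1.
  have n0 : 2 * (1 + z) != 0 by rewrite gt_eqF//; lra.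
  have D2 : is_derive z 1 (fun y : R => 2 * (1 + y)) 2.
    by apply: is_derive_eq; rewrite /GRing.scale /=; ring.
  have V := @is_deriveV _ (fun y => 2 * (1 + y)) z _ _ n0 D2.
  apply: is_derive_eq; rewrite /GRing.scale /=; field; lra.
by rewrite oppr_le0 divr_ge0 ?mulr_ge0 ?exprn_ge0//; lra.
Qed.

Lemma omega_ge0 x : 0 <= x -> 0 <= omega x.
Proof.
move=> x0; apply: le_trans (omega_ge_quadratic x0).
by rewrite divr_ge0 ?sqr_ge0//; lra.
Qed.

End scalar_calculus.

(** * Minimizers of the one-dimensional models *)

Section models.
Context {R : realType}.
Implicit Types (k a b s t e : R).

Lemma lt_of_derive_sign (h dh : R -> R) (c B : R) : 0 < c ->
  (forall x, 0 <= x < B -> is_derive x 1 h (dh x)) ->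
  (forall x, 0 < x < B -> x < c -> dh x < 0) ->
  (forall x, 0 < x < B -> c < x -> 0 < dh x) ->
  c < B -> forall t, 0 <= t < B -> t != c -> h c < h t.
Proof.
move=> c0 hd neg pos cB t /andP[t0 tB]; rewrite neq_lt => /orP[tc|ct].
- apply: (@lt_of_derive_lt0 _ h dh t c tc) => x /andP[tx xc].
    by apply: hd; rewrite (le_trans t0)//= (le_lt_trans xc).
  by apply: neg => //; rewrite (le_lt_trans t0)//= (lt_trans xc).
- apply: (@lt_of_derive_gt0 _ h dh c t ct) => x /andP[cx xt].
    by apply: hd; rewrite (le_trans (ltW c0))//= (le_lt_trans xt).
  by apply: pos => //; rewrite (lt_trans c0)//= (lt_trans xt).
Qed.

(** The function [k^-2 omega (k a y)] has second derivative
[a^2 / (1 + k a y)^2], the extremal solution of the self-concordance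
inequality with value [a^2] at 0.  A negative [k] gives [omega_star]. *)
Lemma is_derive_bregman k a x : k != 0 -> - 1 < k * a * x ->
  is_derive x 1 (fun y => k ^- 2 * omega (k * a * y))
                (a ^+ 2 * x / (1 + k * a * x)).
Proof.
move=> k0 x1; have D := is_derive_omega_scaled x1.
apply: is_derive_eq; rewrite /GRing.scale /=; field.
by rewrite k0 gt_eqF//; lra.
Qed.

Lemma is_derive2_bregman k a x : - 1 < k * a * x ->
  is_derive x 1 (fun y => a ^+ 2 * y / (1 + k * a * y))
                (a ^+ 2 / (1 + k * a * x) ^+ 2).
Proof.
move=> x1; have D := is_derive_slope x1.
rewrite (_ : (fun y => _) =
  (fun y => a ^+ 2 * (y / (1 + k * a * y)))); last first.
  by apply/funext => y; rewrite mulrA.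
apply: is_derive_eq; rewrite /GRing.scale /=; field.
by rewrite gt_eqF//; lra.
Qed.

(** Model of a Newton step minus [f x], where [N] stands for nu. *)
Definition newton_gap k N t := - (t * N ^+ 2) + k ^- 2 * omega (- k * N * t).

(** The derivative is [N^2 (y (1 + k N) - 1) / (1 - k N y)]. *)
Lemma newton_gap_min k N t : 0 < k -> 0 < N -> 0 <= t -> k * N * t < 1 ->
  t != (1 + k * N)^-1 -> newton_gap k N (1 + k * N)^-1 < newton_gap k N t.
Proof.
move=> k0 N0 t0 tB tc.
have kN : 0 < k * N by rewrite mulr_gt0.
have B x : (x < (k * N)^-1) = (k * N * x < 1).
  by rewrite -[(k * N)^-1]mulr1 mulrC ltr_pdivlMr// mulrC.
have C1 x : (x < (1 + k * N)^-1) = (x * (1 + k * N) < 1).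
  by rewrite -[(1 + _)^-1]mul1r ltr_pdivlMr//; lra.
have C2 x : ((1 + k * N)^-1 < x) = (1 < x * (1 + k * N)).
  by rewrite -[(1 + _)^-1]mul1r ltr_pdivrMr//; lra.
apply: (@lt_of_derive_sign (newton_gap k N)
   (fun x => N ^+ 2 * (x * (1 + k * N) - 1) / (1 - k * N * x))
   (1 + k * N)^-1 (k * N)^-1).
- by rewrite invr_gt0; lra.
- move=> x /andP[x0]; rewrite B => xB.
  have x1 : -1 < (- k) * N * x by lra.
  have k0' : - k != 0 by rewrite oppr_eq0 gt_eqF.
  have := is_derive_bregman k0' x1; rewrite sqrrN => D.
  rewrite /newton_gap.
  apply: is_derive_eq; rewrite /GRing.scale /=; field; lra.
- move=> x /andP[x0]; rewrite B C1 => xB xc.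
  by rewrite ltr_pdivrMr ?mul0r ?pmulr_rlt0 ?exprn_gt0//; lra.
- move=> x /andP[x0]; rewrite B C2 => xB xc.
  by rewrite divr_gt0 ?mulr_gt0 ?exprn_gt0//; lra.
- by rewrite ltf_pV2 ?posrE; lra.
- by rewrite t0 B.
- exact: tc.
Qed.

Lemma newton_gap_le k N e : 0 < k -> 0 < e <= N ->
  newton_gap k N (1 + k * N)^-1 <= - (e ^+ 2 / (2 * (1 + k * e))).
Proof.
move=> k0 /andP[e0 eN]; have N0 : 0 < N by lra.
have kN : 0 < k * N by rewrite mulr_gt0.
have ke : 0 < k * e by rewrite mulr_gt0.
have -> : newton_gap k N (1 + k * N)^-1 = - (k ^- 2 * omega (k * N)).
  rewrite /newton_gap /omega.
  have -> : 1 + - k * N / (1 + k * N) = (1 + k * N)^-1 by field; lra.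
  rewrite lnV ?posrE; last lra.
  by field; lra.
rewrite lerN2; apply: (@le_trans _ _ (N ^+ 2 / (2 * (1 + k * N)))).
  rewrite ler_pdivrMr; last lra.
  rewrite mulrAC ler_pdivlMr; last lra.
  have H1 : e ^+ 2 <= N ^+ 2 by rewrite lerXn2r// nnegrE ltW.
  have H2 : e * N * e <= e * N * N by rewrite ler_pM2l// mulr_gt0.
  have : k * (e * N * e) <= k * (e * N * N) by rewrite ler_pM2l.
  by move: H1; rewrite !expr2; lra.
have -> : N ^+ 2 / (2 * (1 + k * N)) =
  k ^- 2 * ((k * N) ^+ 2 / (2 * (1 + k * N))) by field; lra.
by rewrite ler_pM2l ?invr_gt0 ?exprn_gt0// omega_ge_quadratic ?ltW.
Qed.

(** Model of a negative curvature step minus [f x], where [a^2 = s Delta] and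
[b^2 = delta + s Delta]. *)
Definition curvature_gap kF k a b t :=
  - (kF ^- 2 * omega (kF * a * t)) + k ^- 2 * omega (- k * b * t).

Definition curvature_step kF k a b :=
  (a ^+ 2 - b ^+ 2) / (a * b * (kF * b + k * a)).

Lemma curvature_step_gt0 kF k a b : 0 < kF -> 0 < k -> 0 < b < a ->
  0 < curvature_step kF k a b.
Proof.
move=> kF0 k0 /andP[b0 ba]; have a0 : 0 < a by lra.
rewrite divr_gt0//; first by rewrite !expr2; nra.
by rewrite !mulr_gt0// addr_gt0// mulr_gt0.
Qed.

Lemma curvature_step_lt kF k a b : 0 < kF -> 0 < k -> 0 < b < a ->
  k * b * curvature_step kF k a b < 1.
Proof.
move=> kF0 k0 /andP[b0 ba]; have a0 : 0 < a by lra.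
have D0 : 0 < a * b * (kF * b + k * a).
  by rewrite !mulr_gt0// addr_gt0// mulr_gt0.
rewrite mulrA ltr_pdivrMr// mul1r -subr_gt0.
have -> : a * b * (kF * b + k * a) - k * b * (a ^+ 2 - b ^+ 2) =
          kF * a * b ^+ 2 + k * b ^+ 3 by ring.
by rewrite addr_gt0// mulr_gt0 ?exprn_gt0// mulr_gt0.
Qed.

(** The derivative is
[y (y a b (kF b + k a) - (a^2 - b^2)) / ((1 + kF a y) (1 - k b y))], whose
sign on the positive axis is that of [y - curvature_step kF k a b]. *)
Lemma curvature_gap_min kF k a b t : 0 < kF -> 0 < k -> 0 < b < a ->
  0 <= t -> k * b * t < 1 -> t != curvature_step kF k a b ->
  curvature_gap kF k a b (curvature_step kF k a b) < curvature_gap kF k a b t.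
Proof.
move=> kF0 k0 /andP[b0 ba] t0 tB tc; have a0 : 0 < a by lra.
have kb : 0 < k * b by rewrite mulr_gt0.
have ka : 0 < kF * a by rewrite mulr_gt0.
have D0 : 0 < a * b * (kF * b + k * a).
  by rewrite !mulr_gt0// addr_gt0// mulr_gt0.
have B x : (x < (k * b)^-1) = (k * b * x < 1).
  by rewrite -[(k * b)^-1]mulr1 mulrC ltr_pdivlMr// mulrC.
have C1 x : (x < curvature_step kF k a b) =
            (x * (a * b * (kF * b + k * a)) < a ^+ 2 - b ^+ 2).
  by rewrite ltr_pdivlMr.
have C2 x : (curvature_step kF k a b < x) =
            (a ^+ 2 - b ^+ 2 < x * (a * b * (kF * b + k * a))).
  by rewrite ltr_pdivrMr.
apply: (@lt_of_derive_sign (curvature_gap kF k a b)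
   (fun x => x * (x * (a * b * (kF * b + k * a)) - (a ^+ 2 - b ^+ 2))
             / ((1 + kF * a * x) * (1 - k * b * x)))
   (curvature_step kF k a b) (k * b)^-1).
- by rewrite curvature_step_gt0// b0.
- move=> x /andP[x0]; rewrite B => xB.
  have x1 : -1 < (- k) * b * x by lra.
  have k0' : - k != 0 by rewrite oppr_eq0 gt_eqF.
  have x2 : 0 <= kF * a * x by rewrite mulr_ge0// ltW.
  have x2' : -1 < kF * a * x by lra.
  have kF0' : kF != 0 by rewrite gt_eqF.
  have := is_derive_bregman k0' x1; rewrite sqrrN => D.
  have D' := is_derive_bregman kF0' x2'.
  rewrite /curvature_gap.
  by apply: is_derive_eq; rewrite /GRing.scale /=; field; apply/andP; split; lra.
- move=> x /andP[x0]; rewrite B C1 => xB xc.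
  have x2 : 0 < kF * a * x by rewrite mulr_gt0.
  rewrite ltr_pdivrMr ?mul0r ?pmulr_rlt0//; first lra.
  by rewrite mulr_gt0//; lra.
- move=> x /andP[x0]; rewrite B C2 => xB xc.
  have x2 : 0 < kF * a * x by rewrite mulr_gt0.
  by rewrite divr_gt0 ?mulr_gt0//; lra.
- by rewrite B curvature_step_lt// b0.
- by rewrite t0 B.
- exact: tc.
Qed.

(** The minimum is compared with the value at a step of scaled length
[a t = c / (2 K)], for [K = kF + 2 k].  The cubic bounds on [omega] and
[omega_star] reduce the model to [- c (a t)^2 / 2 + K (a t)^3 / 3], and this
choice of [a t] keeps the argument of [omega_star] below 1/2. *)
Lemma curvature_gap_le kF k a b c : 0 < kF -> 0 < k -> 0 < b < a ->
  0 < c -> c * a ^+ 2 <= a ^+ 2 - b ^+ 2 ->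
  curvature_gap kF k a b (curvature_step kF k a b) <=
  - (c ^+ 3 / (12 * (kF + 2 * k) ^+ 2)).
Proof.
move=> kF0 k0 bab c0 cab; have /andP[b0 ba] := bab.
have a0 : 0 < a by lra.
pose K := kF + 2 * k; have K0 : 0 < K by rewrite /K; lra.
have a2 : 0 < a ^+ 2 by rewrite exprn_gt0.
have c1 : c < 1.
  have : 0 < b ^+ 2 by rewrite exprn_gt0.
  by move: cab a2; nra.
pose t := c / (2 * K * a).
have t0 : 0 < t by rewrite divr_gt0// !mulr_gt0.
have at' : a * t = c / (2 * K) by rewrite /t; field; lra.
clearbody t.
have bt : b * t <= a * t by rewrite ler_pM2r// ltW.
have bt0 : 0 < b * t by rewrite mulr_gt0.
have kbt : k * b * t <= 2^-1.
  rewrite -mulrA; apply: (@le_trans _ _ (k * (a * t))).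
    by rewrite ler_pM2l.
  rewrite at' mulrA ler_pdivrMr; last lra.
  by have : k * c <= k * 1; [rewrite ler_pM2l// ltW|rewrite /K; lra].
apply: (@le_trans _ _ (curvature_gap kF k a b t)).
  have [->//|tn] := eqVneq t (curvature_step kF k a b).
  by apply/ltW/curvature_gap_min => //; [exact: ltW|lra].
have x0 : 0 <= kF * a * t by rewrite ltW// mulr_gt0// mulr_gt0.
have y0 : 0 <= k * b * t by rewrite ltW// mulr_gt0// mulr_gt0.
have W := omega_ge_cubic x0.
have V : omega (- (k * b * t)) <= _ := omegaN_le_cubic (introT andP (conj y0 kbt)).
rewrite /curvature_gap !mulNr.
apply: (@le_trans _ _
  (- (kF ^- 2 * ((kF * a * t) ^+ 2 / 2 - (kF * a * t) ^+ 3 / 3)) +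
   k ^- 2 * ((k * b * t) ^+ 2 / 2 + 2 * (k * b * t) ^+ 3 / 3))).
  by apply: lerD; rewrite ?lerN2 ler_pM2l// invr_gt0 exprn_gt0.
have -> : - (kF ^- 2 * ((kF * a * t) ^+ 2 / 2 - (kF * a * t) ^+ 3 / 3)) +
   k ^- 2 * ((k * b * t) ^+ 2 / 2 + 2 * (k * b * t) ^+ 3 / 3) =
   - ((a ^+ 2 - b ^+ 2) * t ^+ 2 / 2) +
   (kF * (a * t) ^+ 3 + 2 * k * (b * t) ^+ 3) / 3.
  by field; lra.
have -> : - (c ^+ 3 / (12 * (kF + 2 * k) ^+ 2)) =
   - (c * (a * t) ^+ 2 / 2) +
   (kF * (a * t) ^+ 3 + 2 * k * (a * t) ^+ 3) / 3.
  rewrite at' /K; field; lra.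
apply: lerD.
  have : c * a ^+ 2 * t ^+ 2 <= (a ^+ 2 - b ^+ 2) * t ^+ 2.
    by rewrite ler_pM2r// exprn_gt0.
  rewrite exprMn mulrA lerN2 ler_pM2r//; lra.
have : (b * t) ^+ 3 <= (a * t) ^+ 3.
  by rewrite lerXn2r// nnegrE ltW// mulr_gt0.
nra.
Qed.

(** The [omega] term only helps; the [omega_star] term increases with [b]. *)
Lemma curvature_gap_le_omega kF k a b c t : 0 < kF -> 0 < k -> 0 <= t ->
  0 <= a -> 0 <= b -> b <= c -> k * c * t < 1 ->
  curvature_gap kF k a b t <= k ^- 2 * omega (- k * c * t).
Proof.
move=> kF0 k0 t0 a0 b0 bc ct1.
rewrite /curvature_gap -[leRHS]add0r !mulNr; apply: lerD.
  rewrite oppr_le0 mulr_ge0 ?invr_ge0 ?exprn_ge0 ?omega_ge0//; try exact: ltW.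
  by rewrite !mulr_ge0// ltW.
rewrite ler_pM2l ?invr_gt0 ?exprn_gt0// omegaN_le//.
by rewrite !mulr_ge0 ?(ltW k0)//= ler_wpM2r// ler_pM2l.
Qed.

(** When [a^2] and [b^2] grow by the same amount, the [omega] term gains at most
half that amount times [t^2] and the [omega_star] term at least as much.  With
[a^2 = s Delta] and [b^2 = delta + s Delta] this says that the model increases
with [s]. *)
Lemma curvature_gap_le_gap kF k a b a' b' t : 0 < kF -> 0 < k -> 0 <= t ->
  0 <= a <= a' -> 0 <= b <= b' -> a' ^+ 2 - a ^+ 2 = b' ^+ 2 - b ^+ 2 ->
  k * b' * t < 1 -> curvature_gap kF k a b t <= curvature_gap kF k a' b' t.
Proof.
move=> kF0 k0 t0 /andP[a0 aa] /andP[b0 bb] ab bt1.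
have kb : k * b * t <= k * b' * t by rewrite ler_wpM2r// ler_pM2l.
have ka : kF * a * t <= kF * a' * t by rewrite ler_wpM2r// ler_pM2l.
have x0 : 0 <= kF * a * t by rewrite !mulr_ge0// ltW.
have := @omega_sub_square_nincr _ (- (k * b' * t)) (- (k * b * t)).
rewrite ltrN2 lerN2 => /(_ bt1 kb) H.
have := @omega_sub_square_nincr _ (kF * a * t) (kF * a' * t).
move=> /(_ _ ka) H'; have {}H' := H' ltac:(lra).
rewrite -(ler_pM2l (_ : 0 < k ^- 2)) in H; last by rewrite invr_gt0 exprn_gt0.
rewrite -(ler_pM2l (_ : 0 < kF ^- 2)) in H'; last by rewrite invr_gt0 exprn_gt0.
have E : k ^- 2 * (((- (k * b * t)) ^+ 2 - (- (k * b' * t)) ^+ 2) / 2) =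
    - ((b' ^+ 2 - b ^+ 2) * t ^+ 2 / 2) by field; lra.
have E' : kF ^- 2 * (((kF * a' * t) ^+ 2 - (kF * a * t) ^+ 2) / 2) =
    (a' ^+ 2 - a ^+ 2) * t ^+ 2 / 2 by field; lra.
rewrite {}E in H; rewrite {}E' ab in H'.
by rewrite /curvature_gap !mulNr; lra.
Qed.

End models.

(** * Self-concordant functions of one variable *)

Section self_concordant_scalar.
Context {R : realType}.
Implicit Types (k a s t e : R).

Lemma powR_3half a : 0 <= a -> a `^ (3 / 2) = Num.sqrt a ^+ 3.
Proof.
move=> a0; rewrite -powR12_sqrt// -powR_mulrn ?powR_ge0// -powRrM.
by congr (_ `^ _); rewrite mulrC.
Qed.

(** Self-concordance says that the derivative of [u^(-1/2)] is at least [- k].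
Shifting [u] by [e] preserves the differential inequality and keeps the base of
the power positive, so zeros of the second derivative need no separate
discussion. *)
Lemma growth_inv_sqrt (u du : R -> R) k s e : 0 <= s -> 0 <= e -> 0 <= k ->
  (forall r, 0 <= r <= s -> is_derive r 1 u (du r)) ->
  (forall r, 0 <= r <= s -> 0 <= u r) ->
  (forall r, 0 <= r <= s -> 0 < u r + e) ->
  (forall r, 0 <= r <= s -> du r <= 2 * k * u r `^ (3 / 2)) ->
  (Num.sqrt (u 0 + e))^-1 <= (Num.sqrt (u s + e))^-1 + k * s.
Proof.
move=> s0 e0 k0 ud u0 ue0 duk.
suff : - (Num.sqrt (u s + e))^-1 - k * s <=
       - (Num.sqrt (u 0 + e))^-1 - k * 0 by lra.
pose S r := Num.sqrt (u r + e).
apply: (@le_of_derive_le0 _ (fun r => - (S r)^-1 - k * r)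
  (fun r => du r / (2 * S r ^+ 3) - k) 0 s s0) => r rs.
  have S0 : 0 < S r by rewrite sqrtr_gt0 ue0.
  have D1 := ud _ rs.
  have D2 : is_derive r 1 (fun r => u r + e) (du r).
    by apply: is_derive_eq; rewrite addr0.
  have D3 := @is_derive1_comp _ Num.sqrt (fun r => u r + e) r _ _
    (is_derive1_sqrt (ue0 _ rs)) D2.
  have S0' : S r != 0 by rewrite gt_eqF.
  have V := @is_deriveV _ S r _ _ S0' D3.
  apply: is_derive_eq; rewrite /GRing.scale /= -/(S r); field; lra.
have S0 : 0 < S r by rewrite sqrtr_gt0 ue0.
rewrite subr_le0 ler_pdivrMr; last by rewrite mulr_gt0 ?exprn_gt0.
apply: le_trans (duk _ rs) _; rewrite powR_3half ?u0//.
rewrite [leRHS]mulrA [k * 2]mulrC ler_wpM2l ?mulr_ge0//.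
by rewrite lerXn2r ?nnegrE ?sqrtr_ge0// ler_wsqrtr// lerDl.
Qed.

Lemma growth_upper (u du : R -> R) k s : 0 <= s -> 0 <= k ->
  (forall r, 0 <= r <= s -> is_derive r 1 u (du r)) ->
  (forall r, 0 <= r <= s -> 0 < u r) ->
  (forall r, 0 <= r <= s -> du r <= 2 * k * u r `^ (3 / 2)) ->
  k * Num.sqrt (u 0) * s < 1 ->
  u s <= Num.sqrt (u 0) ^+ 2 / (1 - k * Num.sqrt (u 0) * s) ^+ 2.
Proof.
move=> s0 k0 ud u0 duk as1.
have H : (Num.sqrt (u 0))^-1 <= (Num.sqrt (u s))^-1 + k * s.
  have := @growth_inv_sqrt u du k s 0 s0 (lexx 0) k0 ud.
  rewrite !addr0; apply => [r rs|r rs|]; last exact: duk.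
    by rewrite ltW// u0.
  by rewrite addr0 u0.
have u00 : 0 < u 0 by rewrite u0// lexx.
have us0 : 0 < u s by rewrite u0// lexx s0.
rewrite -[leLHS](sqr_sqrtr (ltW us0)) -expr_div_n.
have a0 : 0 < Num.sqrt (u 0) by rewrite sqrtr_gt0.
have b0 : 0 < Num.sqrt (u s) by rewrite sqrtr_gt0.
move: (Num.sqrt (u 0)) (Num.sqrt (u s)) a0 b0 H as1 => a b a0 b0 H as1.
have ab0 : 0 < a / (1 - k * a * s) by rewrite divr_gt0//; lra.
apply: lerXn2r; rewrite ?nnegrE ?(ltW b0) ?(ltW ab0)//.
rewrite ler_pdivlMr; last lra.
have := ler_wpM2l (ltW (mulr_gt0 a0 b0)) H.
have -> : a * b / a = b by field; lra.
have -> : a * b * (b^-1 + k * s) = a + a * b * k * s by field; lra.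
lra.
Qed.

(** The roles of the end points are exchanged: the value at 0 is bounded by the one
at [s].  Applied to a line run backwards, this yields the lower growth bound from
the one-sided inequality on the third derivative. *)
Lemma growth_lower (u du : R -> R) k s : 0 <= s -> 0 <= k ->
  (forall r, 0 <= r <= s -> is_derive r 1 u (du r)) ->
  (forall r, 0 <= r <= s -> 0 <= u r) ->
  (forall r, 0 <= r <= s -> du r <= 2 * k * u r `^ (3 / 2)) ->
  Num.sqrt (u s) ^+ 2 / (1 + k * Num.sqrt (u s) * s) ^+ 2 <= u 0.
Proof.
move=> s0 k0 ud u0 duk; apply/ler_addgt0Pr => e e0.
have ue0 r : 0 <= r <= s -> 0 < u r + e by move=> /u0; lra.
have H := growth_inv_sqrt s0 (ltW e0) k0 ud u0 ue0 duk.
have u00 : 0 < u 0 + e by rewrite ue0// lexx.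
have us0 : 0 < u s + e by rewrite ue0// lexx s0.
have B0 : 0 <= Num.sqrt (u s) by exact: sqrtr_ge0.
have B1 : Num.sqrt (u s) <= Num.sqrt (u s + e) by rewrite ler_wsqrtr// lerDl ltW.
rewrite -[leRHS](sqr_sqrtr (ltW u00)) -expr_div_n.
have a0 : 0 < Num.sqrt (u 0 + e) by rewrite sqrtr_gt0.
have b0 : 0 < Num.sqrt (u s + e) by rewrite sqrtr_gt0.
move: (Num.sqrt (u 0 + e)) (Num.sqrt (u s + e)) (Num.sqrt (u s)) a0 b0 H B0 B1.
move=> a b c a0 b0 H c0 cb.
have ks0 : 0 <= k * s by rewrite mulr_ge0.
have kcs0 : 0 <= k * c * s by rewrite mulrAC mulr_ge0.
have cs0 : 0 <= c / (1 + k * c * s) by rewrite divr_ge0//; lra.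
apply: lerXn2r; rewrite ?nnegrE ?(ltW a0)//.
rewrite ler_pdivrMr; last lra.
have := ler_wpM2l (ltW (mulr_gt0 a0 b0)) H.
have -> : a * b / a = b by field; lra.
have -> : a * b * (b^-1 + k * s) = a + a * b * (k * s) by field; lra.
have -> : a * (1 + k * c * s) = a + a * c * (k * s) by ring.
move: ks0; move: (k * s) => K K0 H'.
have [x0|x0] := leP 0 (1 - a * K).
  have : c * (1 - a * K) <= b * (1 - a * K) by rewrite ler_wpM2r.
  lra.
have : 0 <= c * (a * K - 1) by rewrite mulr_ge0//; lra.
lra.
Qed.

Lemma taylor_upper (h dh ddh : R -> R) k a t : 0 <= t -> 0 < k -> 0 <= a ->
  k * a * t < 1 ->
  (forall x, 0 <= x <= t -> is_derive x 1 h (dh x)) ->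
  (forall x, 0 <= x <= t -> is_derive x 1 dh (ddh x)) ->
  (forall x, 0 <= x <= t -> ddh x <= a ^+ 2 / (1 - k * a * x) ^+ 2) ->
  h t <= h 0 + t * dh 0 + k ^- 2 * omega (- k * a * t).
Proof.
move=> t0 k0 a0 kat hd dhd ddhk.
have ka0 : 0 <= k * a by rewrite mulr_ge0// ltW.
have x1 x : 0 <= x <= t -> -1 < (- k) * a * x.
  move=> /andP[x0 xt]; have := ler_wpM2l ka0 xt; lra.
have k0' : - k != 0 by rewrite oppr_eq0 gt_eqF.
suff : h t - h 0 - t * dh 0 - k ^- 2 * omega (- k * a * t) <= 0 by lra.
apply: (@le0_of_derive2_le0 _
  (fun x => h x - h 0 - x * dh 0 - k ^- 2 * omega (- k * a * x))
  (fun x => dh x - dh 0 - a ^+ 2 * x / (1 + - k * a * x))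
  (fun x => ddh x - a ^+ 2 / (1 + - k * a * x) ^+ 2) t t0).
- by rewrite mul0r mulr0 omega0; lra.
- by rewrite mulr0 mul0r; lra.
- move=> x xt; have := is_derive_bregman k0' (x1 _ xt); rewrite sqrrN => D.
  have D' := hd _ xt.
  by apply: is_derive_eq; rewrite /GRing.scale /=; ring.
- move=> x xt; have D := is_derive2_bregman (x1 _ xt).
  have D' := dhd _ xt.
  by apply: is_derive_eq; rewrite /GRing.scale /=; ring.
- by move=> x xt; rewrite subr_le0 !mulNr; exact: ddhk.
Qed.

Lemma taylor_lower (h dh ddh : R -> R) k a t : 0 <= t -> 0 < k -> 0 <= a ->
  (forall x, 0 <= x <= t -> is_derive x 1 h (dh x)) ->
  (forall x, 0 <= x <= t -> is_derive x 1 dh (ddh x)) ->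
  (forall x, 0 <= x <= t -> a ^+ 2 / (1 + k * a * x) ^+ 2 <= ddh x) ->
  h 0 + t * dh 0 + k ^- 2 * omega (k * a * t) <= h t.
Proof.
move=> t0 k0 a0 hd dhd ddhk.
have ka0 : 0 <= k * a by rewrite mulr_ge0// ltW.
have x1 x : 0 <= x <= t -> -1 < k * a * x.
  by move=> /andP[x0 xt]; have := mulr_ge0 ka0 x0; lra.
have k0' : k != 0 by rewrite gt_eqF.
suff : h 0 + t * dh 0 + k ^- 2 * omega (k * a * t) - h t <= 0 by lra.
apply: (@le0_of_derive2_le0 _
  (fun x => h 0 + x * dh 0 + k ^- 2 * omega (k * a * x) - h x)
  (fun x => dh 0 + a ^+ 2 * x / (1 + k * a * x) - dh x)
  (fun x => a ^+ 2 / (1 + k * a * x) ^+ 2 - ddh x) t t0).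
- by rewrite mul0r mulr0 omega0; lra.
- by rewrite mulr0 mul0r; lra.
- move=> x xt; have D := is_derive_bregman k0' (x1 _ xt).
  have D' := hd _ xt.
  by apply: is_derive_eq; rewrite /GRing.scale /=; ring.
- move=> x xt; have D := is_derive2_bregman (x1 _ xt).
  have D' := dhd _ xt.
  by apply: is_derive_eq; rewrite /GRing.scale /=; ring.
- by move=> x xt; rewrite subr_le0; exact: ddhk.
Qed.

End self_concordant_scalar.

(** * Derivatives along lines *)

Section derivatives_along_lines.
Context {R : realType} {n : nat}.
Implicit Types (G : 'cV[R]_n -> R) (x d v : 'cV[R]_n) (U : set 'cV[R]_n).

Lemma is_derive_line G x d (s : R) : differentiable G (x + s *: d) ->
  is_derive s 1 (fun r => G (x + r *: d)) ('D_d G (x + s *: d)).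
Proof.
move=> dG; have D : derivable G (x + s *: d) d by exact: diff_derivable.
have E : (fun h : R => h^-1 *: (((fun r => G (x + r *: d)) \o shift s)
    (h *: 1) - G (x + s *: d))) =
  (fun h : R => h^-1 *: ((G \o shift (x + s *: d)) (h *: d) -
    G (x + s *: d))).
  apply/funext => h /=; congr (_ *: (G _ - _)).
  have -> : h *: (1 : R) = h by rewrite /GRing.scale /= mulr1.
  by rewrite scalerDl addrCA.
split; first by rewrite /derivable E.
by rewrite /derive E.
Qed.

Lemma col_sum_delta d : d = \sum_i d i 0 *: delta_mx i 0.
Proof.
rewrite [LHS]matrix_sum_delta; apply: eq_bigr => i _.
by rewrite big_ord1.
Qed.

Lemma derive_coord G x d : differentiable G x ->
  'D_d G x = \sum_i d i 0 * 'D_(delta_mx i 0) G x.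
Proof.
move=> D; rewrite deriveE// {1}[d]col_sum_delta linear_sum.
by apply: eq_bigr => i _; rewrite linearZ deriveE.
Qed.

Lemma quadE (A : 'M[R]_n) v :
  quad A v = \sum_j v j 0 * \sum_i v i 0 * A i j.
Proof.
rewrite /quad mxE; apply: eq_bigr => j _.
rewrite mxE mulrC; congr (_ * _).
by apply: eq_bigr => i _; rewrite mxE.
Qed.

(** Second derivatives along [d] are values of the Hessian form, because the
first derivative along [d] is the combination of partial derivatives with the
coordinates of [d] at all points of the open set [U]. *)
Lemma quad_derive2 G U x d : open U -> Ck_on 2 U G -> U x ->
  quad (\matrix_(i, j) 'D_(delta_mx i 0) ('D_(delta_mx j 0) G) x) d =
  'D_d ('D_d G) x.
Proof.
move=> oU [dG C1] Ux; rewrite quadE.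
have openU : nbhs x U by apply: open_nbhs_nbhs.
have dG2 v : differentiable ('D_v G) x by have [] := C1 v => + _; exact.
have E : {near x, 'D_d G =1 \sum_(j < n) (d j 0 \*: 'D_(delta_mx j 0) G)}.
  near=> y; rewrite derive_coord; last by apply: dG; near: y; exact: openU.
  by rewrite fct_sumE.
rewrite (near_eq_derive _ E) derive_sum => [|j]; last first.
  by apply: derivableZ; exact: diff_derivable.
apply: eq_bigr => j _.
rewrite deriveZ; last exact: diff_derivable.
rewrite derive_coord//; congr (_ * _).
by apply: eq_bigr => i _; rewrite mxE.
Unshelve. all: by end_near. Qed.

Lemma Ck_onW k G U : Ck_on k.+1 U G -> Ck_on k U G.
Proof.
elim: k G => [|k IH] G /= [dG C].
  by move=> x Ux; exact/differentiable_continuous/dG.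
by split => // v; apply: IH; exact: C.
Qed.

Lemma Ck_on_sub k G (U V : set 'cV[R]_n) : V `<=` U -> Ck_on k U G -> Ck_on k V G.
Proof.
move=> VU; elim: k G => [|k IH] G /=; first by move=> C x /VU; exact: C.
by move=> [dG C]; split => [x /VU|v]; [exact: dG|exact: IH].
Qed.

End derivatives_along_lines.

(** * Self-concordant functions along lines *)

Section self_concordant_lines.
Context {R : realType} {n : nat}.
Implicit Types (f F g : 'cV[R]_n -> \bar R) (x d v : 'cV[R]_n) (k c s t : R).

Lemma quadN (A : 'M[R]_n) d : quad A (- d) = quad A d.
Proof. by rewrite /quad mulmxN linearN /= !mulNmx opprK. Qed.

Lemma dotcNr u v : dotc u (- v) = - dotc u v.
Proof. by rewrite /dotc mulmxN mxE. Qed.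

Lemma domE g x : (forall y, g y <> -oo%E) -> dom g x -> g x = (fine (g x))%:E.
Proof.
move=> gp gx; rewrite fineK// fin_numE; apply/andP; split; first exact/eqP.
by rewrite -ltey.
Qed.

Lemma grad_derive g x d : differentiable (fine \o g) x ->
  dotc (grad g x) d = 'D_d (fine \o g) x.
Proof.
move=> gd; rewrite derive_coord// /dotc mxE; apply: eq_bigr => i _.
by rewrite !mxE mulrC.
Qed.

Lemma quad_hess g x d : open (dom g) -> Ck_dom 2 g -> dom g x ->
  quad (hess g x) d = 'D_d ('D_d (fine \o g)) x.
Proof. exact: quad_derive2. Qed.

Section line.
Variables (k : R) (g : 'cV[R]_n -> \bar R).
Hypotheses (k_gt0 : 0 < k) (g_proper : forall x, g x <> -oo%E).
Hypothesis g_sc : self_concordant k g.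
Let gr := fine \o g.

Let og : open (dom g). Proof. by case: g_sc. Qed.
Let g3 : Ck_dom 3 g. Proof. by case: g_sc. Qed.
Let g2 : Ck_dom 2 g. Proof. exact: Ck_onW. Qed.
Let gd x : dom g x -> differentiable gr x. Proof. by case: g3 => + _; apply. Qed.
Let gd1 x v : dom g x -> differentiable ('D_v gr) x.
Proof. by case: g3 => _ /(_ v)[+ _]; apply. Qed.
Let gd2 x v w : dom g x -> differentiable ('D_w ('D_v gr)) x.
Proof. by case: g3 => _ /(_ v)[_ /(_ w)[+ _]]; apply. Qed.

Lemma sc_third x d : dom g x ->
  'D_d ('D_d ('D_d gr)) x <= 2 * k * ('D_d ('D_d gr) x) `^ (3 / 2).
Proof.
by move=> gx; case: g_sc => _ _ _ /(_ x d gx); rewrite quad_hess.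
Qed.

Lemma sc_line_upper x d t : 0 <= t ->
  (forall y, dom g y -> 0 < quad (hess g y) d) ->
  (forall s, 0 <= s <= t -> dom g (x + s *: d)) ->
  k * Num.sqrt (quad (hess g x) d) * t < 1 ->
  fine (g (x + t *: d)) <= fine (g x) + t * dotc (grad g x) d +
    k ^- 2 * omega (- k * Num.sqrt (quad (hess g x) d) * t).
Proof.
move=> t0 gpd xt at1.
have x00 : x + 0 *: d = x by rewrite scale0r addr0.
have gx : dom g x by rewrite -x00; apply: xt; rewrite lexx.
pose a := Num.sqrt (quad (hess g x) d); rewrite -/a in at1 *.
have aE : a = Num.sqrt ('D_d ('D_d gr) (x + 0 *: d)).
  by rewrite x00 /a quad_hess.
have a0 : 0 <= a by exact: sqrtr_ge0.
have := @taylor_upper _ (fun r => gr (x + r *: d))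
  (fun r => 'D_d gr (x + r *: d)) (fun r => 'D_d ('D_d gr) (x + r *: d))
  k a t t0 k_gt0 a0 at1.
rewrite x00 -grad_derive; last exact: gd.
apply.
- by move=> s st; apply/is_derive_line/gd/xt.
- by move=> s st; apply/is_derive_line/gd1/xt.
move=> s /andP[s0 st].
have st' r : 0 <= r <= s -> dom g (x + r *: d).
  by move=> /andP[r0 rs]; apply: xt; rewrite r0 (le_trans rs).
rewrite aE; apply: (@growth_upper _ (fun r => 'D_d ('D_d gr) (x + r *: d))
  (fun r => 'D_d ('D_d ('D_d gr)) (x + r *: d)) k s s0 (ltW k_gt0)).
- by move=> r rs; apply/is_derive_line/gd2/st'.
- by move=> r rs; rewrite -quad_hess ?gpd//; exact: st'.
- by move=> r rs; apply/sc_third/st'.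
rewrite -aE; apply: le_lt_trans at1.
by rewrite ler_wpM2l// mulr_ge0// ltW.
Qed.

(** [growth_lower] is used from [x + s d] in the direction [- d], where it bounds
the Hessian form at [x + s d] from below by the one at [x]. *)
Lemma sc_line_lower x d t : 0 <= t ->
  (forall y v, dom g y -> 0 <= quad (hess g y) v) ->
  (forall s, 0 <= s <= t -> dom g (x + s *: d)) ->
  fine (g x) + t * dotc (grad g x) d +
    k ^- 2 * omega (k * Num.sqrt (quad (hess g x) d) * t) <=
  fine (g (x + t *: d)).
Proof.
move=> t0 gpd xt.
have x00 : x + 0 *: d = x by rewrite scale0r addr0.
have gx : dom g x by rewrite -x00; apply: xt; rewrite lexx.
pose a := Num.sqrt (quad (hess g x) d); rewrite -/a.
have a0 : 0 <= a by exact: sqrtr_ge0.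
have := @taylor_lower _ (fun r => gr (x + r *: d))
  (fun r => 'D_d gr (x + r *: d)) (fun r => 'D_d ('D_d gr) (x + r *: d))
  k a t t0 k_gt0 a0.
rewrite x00 -grad_derive; last exact: gd.
apply.
- by move=> s st; apply/is_derive_line/gd/xt.
- by move=> s st; apply/is_derive_line/gd1/xt.
move=> s /andP[s0 st].
have back r : x + s *: d + r *: - d = x + (s - r) *: d.
  by rewrite scalerN -scaleNr -addrA -scalerDl.
have st' r : 0 <= r <= s -> dom g (x + s *: d + r *: - d).
  move=> /andP[r0 rs]; rewrite back; apply: xt.
  by rewrite subr_ge0 rs/= (le_trans _ st)// gerBl.
have qx r : 0 <= r <= s -> 'D_(- d) ('D_(- d) gr) (x + s *: d + r *: - d) =
    quad (hess g (x + s *: d + r *: - d)) d.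
  by move=> rs; rewrite -quad_hess ?quadN//; exact: st'.
have := @growth_lower _
  (fun r => 'D_(- d) ('D_(- d) gr) (x + s *: d + r *: - d))
  (fun r => 'D_(- d) ('D_(- d) ('D_(- d) gr)) (x + s *: d + r *: - d))
  k s s0 (ltW k_gt0).
rewrite !qx ?lexx ?s0// back subrr x00 scale0r addr0 -/a quad_hess//; last first.
  by apply: xt; rewrite s0.
apply.
- by move=> r rs; apply/is_derive_line/gd2/st'.
- by move=> r rs; rewrite qx// gpd//; exact: st'.
- by move=> r rs; apply/sc_third/st'.
Qed.

(** Let [z] be the first parameter where the line leaves the domain.  Before [z]
the upper bound keeps [g] below a constant [B]; as the epigraph is closed,
[x + z d] is in the domain, and as the domain is open, so are the points just
after it. *)
Lemma sc_line_dom x d t : dom g x -> 0 <= t ->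
  (forall y, dom g y -> 0 < quad (hess g y) d) ->
  k * Num.sqrt (quad (hess g x) d) * t < 1 ->
  forall s, 0 <= s <= t -> dom g (x + s *: d).
Proof.
move=> gx t0 gpd at1; apply: contrapT => /existsNP[s1 /not_implyP[s1t gs1]].
pose a := Num.sqrt (quad (hess g x) d); rewrite -/a in at1.
have ka0 : 0 <= k * a by rewrite mulr_ge0 ?sqrtr_ge0// ltW.
pose Z := [set s | 0 <= s <= t /\ ~ dom g (x + s *: d)].
have Zne : Z !=set0 by exists s1.
have Zlb : has_inf Z by split => //; exists 0 => s [/andP[]].
pose z := inf Z.
have zs s : Z s -> z <= s by move=> Zs; apply: ge_inf => //; case: Zlb.
have z0 : 0 <= z by apply: lb_le_inf => // s [/andP[]].
have zt : z <= t by apply: (le_trans (zs _ (conj s1t gs1))); case/andP: s1t.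
have before s : 0 <= s < z -> dom g (x + s *: d).
  move=> /andP[s0 sz]; apply: contrapT => gs.
  have /zs : Z s by split => //; rewrite s0 ltW// (lt_le_trans sz).
  by rewrite leNgt sz.
pose B := fine (g x) + t * `|dotc (grad g x) d| + k ^- 2 * omega (- k * a * t).
have bound s : 0 <= s < z -> (g (x + s *: d) <= B%:E)%E.
  move=> /andP[s0 sz].
  have sx r : 0 <= r <= s -> dom g (x + r *: d).
    by move=> /andP[r0 rs]; apply: before; rewrite r0 (le_lt_trans rs).
  have kst : k * a * s <= k * a * t.
    by rewrite ler_wpM2l// (le_trans (ltW sz)).
  rewrite domE//; last by apply: sx; rewrite s0 lexx.
  rewrite lee_fin; apply: le_trans (sc_line_upper s0 gpd sx _) _.
    exact: le_lt_trans at1.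
  rewrite -/a; apply: lerD.
    rewrite lerD2l; apply: (le_trans (ler_norm _)).
    by rewrite normrM ger0_norm// ler_wpM2r// (le_trans (ltW sz)).
  rewrite ler_pM2l ?invr_gt0 ?exprn_gt0// !mulNr.
  by rewrite omegaN_le// mulr_ge0.
have gz : dom g (x + z *: d).
  have [->|zn0] := eqVneq z 0; first by rewrite scale0r addr0.
  have zgt0 : 0 < z by rewrite lt_neqAle eq_sym zn0.
  have [[cg _] _ _ _] := g_sc.
  suff : epigraph g (x + z *: d, B).
    by rewrite /epigraph /= /dom /= => /le_lt_trans; apply; exact: ltry.
  apply: (@closed_cvg _ _ (z^'-) _ (fun s : R => (x + s *: d, B : R^o))
    (epigraph g)) => //.
    near=> s; rewrite /epigraph /=; apply: bound; apply/andP; split.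
      by near: s; apply: nbhs_left_ge.
    by near: s; exact: nbhs_left_lt.
  have c1 : (x + s *: d) @[s --> z^'-] --> x + z *: d.
    apply: cvg_at_left_filter; apply: cvgD; first exact: cvg_cst.
    by apply: cvgZr_tmp; exact: cvg_id.
  have c2 : (B : R^o) @[s --> z^'-] --> (B : R^o) by exact: cvg_cst.
  exact: (cvg_pair c1 c2).
have : \forall s \near z, dom g (x + s *: d).
  have c : (x + s *: d) @[s --> z] --> x + z *: d.
    by apply: cvgD; [exact: cvg_cst|apply: cvgZr_tmp; exact: cvg_id].
  by apply: c; apply: open_nbhs_nbhs.
move=> [e /= e0 ze].
have [s Zs sz] := inf_adherent e0 Zlb.
case: (Zs) => _; apply; apply: ze => /=.
by rewrite distrC ger0_norm ?subr_ge0 ?zs// ltrBlDl.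
Unshelve. all: by end_near. Qed.

Lemma sc_upper x d t : dom g x -> 0 <= t ->
  (forall y, dom g y -> 0 < quad (hess g y) d) ->
  k * Num.sqrt (quad (hess g x) d) * t < 1 ->
  fine (g (x + t *: d)) <= fine (g x) + t * dotc (grad g x) d +
    k ^- 2 * omega (- k * Num.sqrt (quad (hess g x) d) * t).
Proof.
by move=> gx t0 gpd at1; apply: sc_line_upper => // s; exact: sc_line_dom.
Qed.

End line.

(** If the form were negative at [x] along [d], it would be so near [x], and
[G (x + s d) + G (x - s d)] would decrease from [2 G x], against strict
convexity at the midpoint. *)
Lemma strictly_convex_hess_ge0 F x d : (forall y, F y <> -oo%E) ->
  open (dom F) -> Ck_dom 3 F -> strictly_convex F -> dom F x ->
  0 <= quad (hess F x) d.
Proof.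
move=> Fp oF F3 Fc Fx; rewrite leNgt; apply/negP => q0.
have F2 : Ck_dom 2 F by exact: Ck_onW.
pose G := fine \o F.
have Gd y : dom F y -> differentiable G y by case: F3 => + _; apply.
have Gd1 y v : dom F y -> differentiable ('D_v G) y.
  by case: F3 => _ /(_ v)[+ _]; apply.
have Gd2 y v w : dom F y -> differentiable ('D_w ('D_v G)) y.
  by case: F3 => _ /(_ v)[_ /(_ w)[+ _]]; apply.
have d0 : d != 0.
  by apply: contraTneq q0 => ->; rewrite /quad mulmx0 mxE ltxx.
have /open_nbhs_nbhs nF : open_nbhs x (dom F) by [].
have nq : \forall y \near x, dom F y /\ 'D_d ('D_d G) y < 0.
  near=> y; split; first by near: y.
  near: y; apply: (cvgr_lt ('D_d ('D_d G) x)); last by rewrite -quad_hess.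
  exact: differentiable_continuous (Gd2 x d d Fx).
have line v : (x + s *: v) @[s --> (0:R)] --> x.
  rewrite -[X in _ --> X]addr0 -[X in _ + X](scale0r v).
  by apply: cvgD; [exact: cvg_cst|apply: cvgZr_tmp; exact: cvg_id].
have [e /= e0 ep] := line d _ nq.
have [e' /= e'0 em] := line (- d) _ nq.
pose t := Num.min e e' / 2.
have t0 : 0 < t by rewrite divr_gt0// lt_min e0.
have te : t < e.
  have : Num.min e e' <= e by rewrite ge_min lexx.
  by rewrite /t; move: (Num.min e e') => m; lra.
have te' : t < e'.
  have : Num.min e e' <= e' by rewrite ge_min lexx orbT.
  by rewrite /t; move: (Num.min e e') => m; lra.
have P s : 0 <= s <= t ->
    dom F (x + s *: d) /\ 'D_d ('D_d G) (x + s *: d) < 0.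
  move=> /andP[s0 st]; apply: ep => /=.
  by rewrite sub0r normrN ger0_norm// (le_lt_trans st).
have M s : 0 <= s <= t ->
    dom F (x + s *: - d) /\ 'D_d ('D_d G) (x + s *: - d) < 0.
  move=> /andP[s0 st]; apply: em => /=.
  by rewrite sub0r normrN ger0_norm// (le_lt_trans st).
have tt : 0 <= t <= t by rewrite lexx ltW.
have : G (x + t *: d) + G (x + t *: - d) - 2 * G x <= 0.
  apply: (@le0_of_derive2_le0 _
    (fun s => G (x + s *: d) + G (x + s *: - d) - 2 * G x)
    (fun s => 'D_d G (x + s *: d) + 'D_(- d) G (x + s *: - d))
    (fun s => 'D_d ('D_d G) (x + s *: d) +
              'D_(- d) ('D_(- d) G) (x + s *: - d)) t (ltW t0)).
  - by rewrite !scale0r !addr0; ring.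
  - by rewrite !scale0r !addr0 -!grad_derive; [rewrite dotcNr subrr|exact: Gd..].
  - move=> s st; have D := is_derive_line (Gd _ (P _ st).1).
    have D' := is_derive_line (Gd _ (M _ st).1).
    by apply: is_derive_eq; rewrite /GRing.scale /=; ring.
  - move=> s st; have D := is_derive_line (Gd1 _ d (P _ st).1).
    have D' := is_derive_line (Gd1 _ (- d) (M _ st).1).
    by apply: is_derive_eq.
  - move=> s st; have [Fp1 Dp] := P _ st; have [Fm Dm] := M _ st.
    have -> : 'D_(- d) ('D_(- d) G) (x + s *: - d) =
        'D_d ('D_d G) (x + s *: - d).
      by rewrite -(quad_hess d oF F2 Fm) -(quad_hess (- d) oF F2 Fm) quadN.
    move: Dp Dm.
    move: ('D_d ('D_d G) (x + s *: d)) ('D_d ('D_d G) (x + s *: - d)) => p q.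
    lra.
have [Fp1 _] := P _ tt; have [Fm _] := M _ tt.
have ne : x + t *: d != x + t *: - d.
  rewrite -subr_eq0 opprD addrACA subrr add0r scalerN opprK -scalerDl.
  by rewrite scaler_eq0 negb_or d0 andbT gt_eqF// addr_gt0.
have := Fc _ _ (2^-1) Fp1 Fm ne.
have -> : 2^-1 *: (x + t *: d) + (1 - 2^-1) *: (x + t *: - d) = x.
  have -> : 1 - 2^-1 = 2^-1 :> R by lra.
  rewrite -scalerDr addrACA scalerN subrr addr0 -mulr2n.
  by rewrite -[x *+ 2]scaler_nat scalerA mulVf ?scale1r// pnatr_eq0.
have h01 : 0 < (2^-1 : R) < 1 by apply/andP; split; lra.
move=> /(_ h01); rewrite (domE Fp Fx) (domE Fp Fp1) (domE Fp Fm).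
rewrite -!EFinM -EFinD lte_fin /G /=; lra.
Unshelve. all: by end_near. Qed.

Lemma hess_linear_comb f F g (U : set 'cV[R]_n) c x : open U ->
  Ck_on 2 U (fine \o f) -> Ck_on 2 U (fine \o F) ->
  (forall y, U y -> fine (g y) = fine (f y) + c * fine (F y)) -> U x ->
  hess g x = hess f x + c *: hess F x.
Proof.
move=> oU [fd f1] [Fd F1] gE Ux.
have nU y : U y -> nbhs y U by move=> Uy; exact: open_nbhs_nbhs.
have E y : U y -> {near y, fine \o g =1 fine \o f + c \*: (fine \o F)}.
  by move=> Uy; near=> z; apply: gE; near: z; exact: nU.
have E1 v y : U y ->
    'D_v (fine \o g) y = ('D_v (fine \o f) + c \*: 'D_v (fine \o F)) y.
  move=> Uy; rewrite (near_eq_derive _ (E _ Uy)) deriveD.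
  - by rewrite deriveZ//; exact/diff_derivable/Fd.
  - exact/diff_derivable/fd.
  - by apply: derivableZ; exact/diff_derivable/Fd.
apply/matrixP => i j; rewrite !mxE.
have E2 : {near x, 'D_(delta_mx j 0) (fine \o g) =1
    'D_(delta_mx j 0) (fine \o f) + c \*: 'D_(delta_mx j 0) (fine \o F)}.
  by near=> z; apply: E1; near: z; exact: nU.
have df : derivable ('D_(delta_mx j 0) (fine \o f)) x (delta_mx i 0).
  by have [+ _] := f1 (delta_mx j 0) => /(_ _ Ux)/diff_derivable; apply.
have dF : derivable ('D_(delta_mx j 0) (fine \o F)) x (delta_mx i 0).
  by have [+ _] := F1 (delta_mx j 0) => /(_ _ Ux)/diff_derivable; apply.
rewrite (near_eq_derive _ E2) deriveD; [|exact: df|exact: derivableZ].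
by rewrite deriveZ; [|exact: dF].
Unshelve. all: by end_near. Qed.

Lemma dotc_grad_add f F g (U : set 'cV[R]_n) x d : open U ->
  Ck_on 1 U (fine \o f) -> Ck_on 1 U (fine \o F) ->
  (forall y, U y -> fine (g y) = fine (f y) + fine (F y)) -> U x ->
  dotc (grad g x) d = dotc (grad f x) d + dotc (grad F x) d.
Proof.
move=> oU [fd f1] [Fd F1] gE Ux.
suff -> : grad g x = grad f x + grad F x.
  by rewrite /dotc linearD mulmxDl mxE.
apply/matrixP => i j; rewrite !mxE.
have nU : nbhs x U by exact: open_nbhs_nbhs.
have E : {near x, fine \o g =1 fine \o f + (fine \o F)}.
  by near=> z; apply: gE; near: z.
by rewrite (near_eq_derive _ E) deriveD;
  [|exact/diff_derivable/fd|exact/diff_derivable/Fd].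
Unshelve. all: by end_near. Qed.

End self_concordant_lines.

(** * Newton directions and exact model minimization *)

Section linear_algebra_and_argmin.
Context {R : realType}.

Lemma pos_def_unitmx n (A : 'M[R]_n) : pos_def A -> A \in unitmx.
Proof.
move=> Apd; rewrite unitmxE unitfE; apply/negP => /det0P[v v0 vA].
have /Apd : v^T != 0.
  by apply: contra v0 => /eqP v0; rewrite -[v]trmxK v0 trmx0.
by rewrite /quad trmxK vA mul0mx mxE ltxx.
Qed.

Lemma mulmx_pinv n (A : 'M[R]_n) : pos_def A -> A *m Defs.pinv A = 1%:M.
Proof.
move=> /pos_def_unitmx Au.
have [E _ _ _] : is_pinv A (Defs.pinv A).
  apply: (@xgetPex _ 0 [set B | is_pinv A B]); exists (invmx A).
  by split; rewrite ?mulmxV ?mulVmx ?mul1mx ?trmx1.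
by rewrite -[LHS](mulmxK Au) E mulmxV.
Qed.

Lemma dotcC n (u v : 'cV[R]_n) : dotc u v = dotc v u.
Proof. by rewrite /dotc -[u^T *m v]trmxK mxE trmx_mul trmxK. Qed.

(** The identity [nu^2 = - grad f . d] for the Newton direction [d], which makes the
linear term of the expansion of [f] agree with the one of the model. *)
Lemma quad_pinv n (A : 'M[R]_n) b : pos_def A ->
  quad A (- (Defs.pinv A *m b)) = - dotc b (- (Defs.pinv A *m b)).
Proof.
move=> Apd; rewrite /quad -mulmxA mulmxN mulmxA mulmx_pinv// mul1mx.
by rewrite mulmxN mxE -/(dotc _ _) dotcC.
Qed.

Lemma quad_eigen n (A : 'M[R]_n) (a : R) v :
  enorm v = 1 -> A *m v = a *: v -> quad A v = a.
Proof.
move=> v1 Av; rewrite /quad -mulmxA Av -scalemxAr mxE -/(dotc v v).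
have vv0 : 0 <= dotc v v.
  by rewrite /dotc mxE sumr_ge0// => i _; rewrite mxE -expr2 sqr_ge0.
by rewrite -(sqr_sqrtr vv0) -/(enorm v) v1 expr1n mulr1.
Qed.

Lemma enorm1_neq0 n (v : 'cV[R]_n) : enorm v = 1 -> v != 0.
Proof.
move=> v1; apply/eqP => v0; move/eqP: v1.
by rewrite v0 /enorm /dotc mulmx0 mxE sqrtr0 eq_sym oner_eq0.
Qed.

Lemma quadD n (A B : 'M[R]_n) d : quad (A + B) d = quad A d + quad B d.
Proof. by rewrite /quad mulmxDr mulmxDl mxE. Qed.

Lemma quadDZ n (A B : 'M[R]_n) c d :
  quad (A + c *: B) d = quad A d + c * quad B d.
Proof. by rewrite /quad mulmxDr mulmxDl -scalemxAr -scalemxAl !mxE. Qed.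

Lemma argmin0_strict (m : R -> \bar R) (t : R) : 0 <= t ->
  (forall u, 0 <= u -> u != t -> (m t < m u)%E) -> argmin0 m = t.
Proof.
move=> t0 mt; have tmin : minimizer m t.
  split => // u u0; have [->//|ut] := eqVneq u t.
  by apply/ltW/mt.
apply: xget_unique => [|u [_ /(_ _ tmin)]//]; split => // u [u0 uP].
by apply/eqP; apply: contraT => /(mt _ u0); rewrite ltNge uP.
Qed.

Lemma omega_starE (z : R) :
  omega_star z%:E = if z < 1 then (omega (- z))%:E else +oo%E.
Proof. by []. Qed.

(** The models of both kinds of direction have this shape: finite up to the pole of
[omega_star], infinite beyond it. *)
Lemma argmin0_gap (m : R -> \bar R) (h : R -> R) (c B t : R) : 0 <= t ->
  B * t < 1 ->
  (forall u, 0 <= u -> m u = if B * u < 1 then (c + h u)%:E else +oo%E) ->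
  (forall u, 0 <= u -> B * u < 1 -> u != t -> h t < h u) ->
  argmin0 m = t.
Proof.
move=> t0 tB mE ht; apply: argmin0_strict => // u u0 ut.
rewrite !mE// tB; case: ifPn => uB; last exact: ltry.
by rewrite lte_fin ltrD2l ht.
Qed.

End linear_algebra_and_argmin.

Section iteration.
Context {R : realType} {n : nat}.
Variables (f F : 'cV[R]_n -> \bar R) (k kF : R) (p : arm_params R).
Variables (eg eH : R).
Hypotheses (f_proper : forall x, f x <> -oo%E) (F_proper : forall x, F x <> -oo%E).
Hypotheses (k_gt0 : 0 < k) (kF_gt0 : 0 < kF) (f_C3 : Ck_dom 3 f).
Hypotheses (f_sc : based_self_concordant F k f) (F_strict : strictly_convex F).
Hypothesis F_sc : self_concordant kF F.
Hypotheses (eg_gt0 : 0 < eg) (eH_gt0 : 0 < eH) (p_ok : arm_params_ok p).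
Implicit Types (x d v : 'cV[R]_n) (s t : R).
Let g := fun x => (f x + F x)%E.

Let fF : dom f `<=` dom F. Proof. by case: f_sc. Qed.
Let g_sc : self_concordant k g. Proof. by case: f_sc. Qed.
Let oF : open (dom F). Proof. by case: F_sc. Qed.
Let F3 : Ck_dom 3 F. Proof. by case: F_sc. Qed.

Let g_proper x : g x <> -oo%E.
Proof.
rewrite /g; move: (@f_proper x) (@F_proper x).
by case: (f x) => [a||]//; case: (F x) => [b||].
Qed.

Let dom_g : dom g = dom f.
Proof.
apply/seteqP; split => x; rewrite /dom /g /=; last first.
  move=> fx; have := fF fx; rewrite /dom /= => Fx.
  by rewrite lte_add_pinfty.
by case: (f x) => [a||]//; [rewrite ltry|case: (F x) (@F_proper x)].
Qed.

Let of' : open (dom f). Proof. by rewrite -dom_g; case: g_sc. Qed.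
Let F3f : Ck_on 3 (dom f) (fine \o F). Proof. exact: (Ck_on_sub fF). Qed.

Let f2 : Ck_on 2 (dom f) (fine \o f). Proof. exact: (@Ck_onW _ _ 2 _ _ f_C3). Qed.
Let F2f : Ck_on 2 (dom f) (fine \o F). Proof. exact: (@Ck_onW _ _ 2 _ _ F3f). Qed.

Lemma fine_comb c x : dom f x ->
  fine (f x + c%:E * F x)%E = fine (f x) + c * fine (F x).
Proof.
by move=> fx; rewrite (domE f_proper fx) (domE F_proper (fF fx)).
Qed.

Lemma hess_regularized s x : dom f x ->
  hess (regularized f F s) x = hess f x + s *: hess F x.
Proof.
move=> fx; have comb y : dom f y -> fine (regularized f F s y) = _ := @fine_comb s y.
exact: (hess_linear_comb of' f2 F2f comb fx).
Qed.

Lemma hess_sum x : dom f x -> hess g x = hess f x + hess F x.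
Proof.
move=> fx; have := hess_regularized 1 fx; rewrite scale1r => <-.
by congr (hess _ x); apply/funext => y; rewrite /regularized mul1e.
Qed.

Lemma quad_hess_sum x d : dom f x ->
  quad (hess g x) d = quad (hess f x) d + quad (hess F x) d.
Proof. by move=> fx; rewrite hess_sum// quadD. Qed.

Lemma quad_hessF_ge0 x d : dom F x -> 0 <= quad (hess F x) d.
Proof. exact: strictly_convex_hess_ge0. Qed.

Lemma quad_sum_gt0 x d : dom f x -> d != 0 ->
  0 < quad (hess f x) d + quad (hess F x) d.
Proof. by move=> fx d0; rewrite -quad_hess_sum//; case: f_sc => _ _; apply. Qed.

Lemma quad_regularized_gt0 s x d : dom f x -> 1 <= s -> d != 0 ->
  0 < quad (hess f x) d + s * quad (hess F x) d.
Proof.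
move=> fx s1 /(quad_sum_gt0 fx) H; have := quad_hessF_ge0 d (fF fx).
by move=> q0; apply: (lt_le_trans H); rewrite lerD2l ler_peMl.
Qed.

(** The upper bound for [f + F] minus the lower bound for [F].  The segment stays in
the domain of [f + F], which is the domain of [f]. *)
Lemma based_sc_descent x d t : dom f x -> d != 0 -> 0 <= t ->
  let q := quad (hess f x) d + quad (hess F x) d in
  k * Num.sqrt q * t < 1 ->
  dom f (x + t *: d) /\
  fine (f (x + t *: d)) <= fine (f x) + t * dotc (grad f x) d +
    curvature_gap kF k (Num.sqrt (quad (hess F x) d)) (Num.sqrt q) t.
Proof.
move=> fx d0 t0 q qt.
have gpd y : dom g y -> 0 < quad (hess g y) d.
  by rewrite dom_g => fy; rewrite quad_hess_sum// quad_sum_gt0.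
have gx : dom g x by rewrite dom_g.
have qE : q = quad (hess g x) d by rewrite quad_hess_sum.
rewrite qE in qt *.
have line := sc_line_dom k_gt0 g_proper g_sc gx t0 gpd qt.
have up := sc_upper k_gt0 g_proper g_sc gx t0 gpd qt.
have xt : dom f (x + t *: d) by rewrite -dom_g; apply: line; rewrite t0 lexx.
have lo : fine (F x) + t * dotc (grad F x) d +
    kF ^- 2 * omega (kF * Num.sqrt (quad (hess F x) d) * t) <=
    fine (F (x + t *: d)).
  apply: (sc_line_lower kF_gt0 F_sc t0).
    by move=> y v Fy; exact: quad_hessF_ge0.
  by move=> s /line; rewrite dom_g => /fF.
split=> //; move: up.
have fineg y : dom f y -> fine (g y) = fine (f y) + fine (F y).
  by move=> fy; rewrite -[fine (F y)]mul1r -fine_comb// mul1e.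
rewrite (dotc_grad_add (f := f) (F := F) d of' _ _ fineg)//; last 2 first.
  exact: (@Ck_onW _ _ 1 _ _ f2).
  exact: (@Ck_onW _ _ 1 _ _ F2f).
rewrite !fineg// /curvature_gap !mulNr; lra.
Qed.

Lemma newton_modelE x s v t (N : R) : dom f x -> newton_case f F eH x s v ->
  nu f F x s = N%:E ->
  arm_model f F k kF eH x s v t =
  if k * N * t < 1 then (fine (f x) + newton_gap k N t)%:E else +oo%E.
Proof.
move=> fx nc nuE; rewrite /arm_model nc nuE (domE f_proper fx).
rewrite -!EFinM omega_starE (_ : k * t * N = k * N * t); last by ring.
rewrite -EFinB; case: ifPn => _ /=.
  by rewrite -EFinM -EFinD /newton_gap expr2 !mulNr addrA.
by rewrite gt0_muley ?lte_fin ?invr_gt0 ?exprn_gt0// addey.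
Qed.

Lemma curvature_modelE x s v t (q : R) : dom f x -> ~~ newton_case f F eH x s v ->
  q = arm_delta f F eH x s v + s * arm_Delta f F eH x s v -> 0 <= q ->
  arm_model f F k kF eH x s v t =
  if k * Num.sqrt q * t < 1 then
    (fine (f x) + curvature_gap kF k
       (Num.sqrt (s * arm_Delta f F eH x s v)) (Num.sqrt q) t)%:E
  else +oo%E.
Proof.
move=> fx nc qE q0; rewrite /arm_model (negbTE nc) -qE (domE f_proper fx).
rewrite /esqrt ltNge q0 -!EFinM omega_starE.
rewrite (_ : k * t * Num.sqrt q = k * Num.sqrt q * t); last by ring.
rewrite -EFinB; case: ifPn => _.
  rewrite -EFinM -EFinD /curvature_gap !mulNr addrA.
  by congr (_ - _ * omega _ + _)%:E; ring.
by rewrite gt0_muley ?lte_fin ?invr_gt0 ?exprn_gt0// addey.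
Qed.

(** The products by a possibly infinite nu vanish at [t = 0]. *)
Lemma arm_model0 x s v : dom f x -> arm_model f F k kF eH x s v 0 = f x.
Proof.
move=> fx; have o0 : omega_star (0%:E : \bar R) = 0%E.
  by rewrite omega_starE ltr01 oppr0 omega0.
rewrite /arm_model !(mule0, mul0e) o0 mule0 !mulr0 mul0r omega0 mulr0.
by rewrite !sube0 !adde0; case: ifP.
Qed.

Lemma arm_ratio_zero_step x s v : dom f x ->
  arm_steplength f F k kF eH x s v = 0 -> arm_ratio f F k kF eH x s v = 0%E.
Proof.
move=> fx t0; rewrite /arm_ratio /arm_trial t0 scale0r addr0 arm_model0//.
by rewrite (domE f_proper fx) subee// mul0e.
Qed.

(** Lower bound on the decrease of the model promised by a step of positive length:
the first term comes from Newton steps, the second one from negative curvature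
steps, [Num.sqrt eH ^+ 3] being [eH `^ (3 / 2)]. *)
Definition arm_gain := Num.min (eg ^+ 2 / (2 * (1 + k * eg)))
  (Num.sqrt eH ^+ 3 / (12 * (kF + 2 * k) ^+ 2)).

(** The alternative that drives the analysis of an iteration that does not stop.
Either the step has length zero, so that the ratio is 0, and sigma is below 1;
or the model promises a decrease [D], and [f] achieves it if sigma is at
least 1. *)
Definition arm_progress x s v :=
  (arm_steplength f F k kF eH x s v = 0 /\ s < 1) \/
  exists D, [/\ 0 < D,
    arm_gain <= D,
    arm_model f F k kF eH x s v (arm_steplength f F k kF eH x s v) =
      (fine (f x) - D)%:E &
    1 <= s -> dom f (arm_trial f F k kF eH x s v) /\
      fine (f (arm_trial f F k kF eH x s v)) <= fine (f x) - D].

(** Writing [Q] for the Hessian form of [f + s F] along [d], nu is infinite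
for [Q < 0], and the step has length zero; this excludes [s >= 1], which makes
the Hessian positive definite. *)
Lemma newton_progress x s v : dom f x -> newton_case f F eH x s v ->
  (eg%:E < nu f F x s)%E -> arm_progress x s v.
Proof.
move=> fx nc egnu.
pose d := newton_dir f F x s.
have dE : arm_dir f F eH x s v = d by rewrite /arm_dir nc.
pose Q := quad (hess (regularized f F s) x) d.
have QE : arm_delta f F eH x s v + s * arm_Delta f F eH x s v = Q.
  by rewrite /arm_delta /arm_Delta dE /Q hess_regularized// quadDZ.
have H1 : 1 <= s -> pos_def (hess (regularized f F s) x).
  by move=> s1 w w0; rewrite hess_regularized// quadDZ quad_regularized_gt0.
(* For [Q < 0] nu is infinite and the step length is 0 by convention. *)
have [Q0|Q0] := ltP Q 0.
  left; split; first by rewrite /arm_steplength QE ltNge ltW.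
  rewrite ltNge; apply/negP => /H1 pd; move: Q0.
  have [d0|/pd] := eqVneq d 0; last by rewrite -/Q => /ltW; rewrite leNgt => /negP.
  by rewrite /Q d0 /quad mulmx0 mxE ltxx.
pose N := Num.sqrt Q.
have nuE : nu f F x s = N%:E by rewrite /nu -/d -/Q /esqrt ltNge Q0.
have egN : eg < N by rewrite -lte_fin -nuE.
have N0 : 0 < N by apply: lt_trans egN.
have Qgt0 : 0 < Q by rewrite -sqrtr_gt0.
have QN : Q = N ^+ 2 by rewrite sqr_sqrtr.
pose t := (1 + k * N)^-1.
have kN : 0 < k * N by rewrite mulr_gt0.
have t0 : 0 <= t by rewrite invr_ge0; lra.
have kNt : k * N * t < 1 by rewrite /t ltr_pdivrMr; lra.
have mE u := newton_modelE u fx nc nuE.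
have tE : arm_steplength f F k kF eH x s v = t.
  rewrite /arm_steplength QE Qgt0.
  apply: (@argmin0_gap _ _ (newton_gap k N) (fine (f x)) (k * N)) => //.
  by move=> u u0 ku ut; exact: newton_gap_min.
right; exists (- newton_gap k N t).
have dec : newton_gap k N t <= - (eg ^+ 2 / (2 * (1 + k * eg))).
  by apply: newton_gap_le => //; rewrite eg_gt0 ltW.
have eg0 : 0 < eg ^+ 2 / (2 * (1 + k * eg)).
  by rewrite divr_gt0 ?exprn_gt0// mulr_gt0// addr_gt0// mulr_gt0.
split; [lra| |by rewrite tE mE kNt opprK|].
  by rewrite /arm_gain ge_min; apply/orP; left; lra.
move=> s1; rewrite /arm_trial tE dE opprK.
have d0 : d != 0.
  by apply: contraTneq Qgt0 => d0; rewrite /Q d0 /quad mulmx0 mxE ltxx.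
pose q := quad (hess f x) d + quad (hess F x) d.
have Fd0 : 0 <= quad (hess F x) d by apply: quad_hessF_ge0; exact: fF.
have qQ : q <= Q.
  rewrite -QE /arm_delta /arm_Delta dE /q lerD2l.
  by rewrite ler_peMl.
have sqN : Num.sqrt q <= N by rewrite ler_wsqrtr.
have kq : k * Num.sqrt q * t <= k * N * t.
  by rewrite ler_wpM2r// ler_pM2l.
have [] := based_sc_descent fx d0 t0 (le_lt_trans kq kNt).
split=> //.
have : dotc (grad f x) d = - N ^+ 2.
  by rewrite -QN /Q quad_pinv ?opprK//; exact: H1.
move=> gd; rewrite gd in b.
apply: (le_trans b); rewrite /newton_gap mulrN -addrA lerD2l lerD2l.
exact: (curvature_gap_le_omega kF_gt0 k_gt0 t0 (sqrtr_ge0 _) (sqrtr_ge0 _) sqN kNt).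
Qed.

(** The test on the least eigenvalue reads [a^2 - b^2 > sqrt eH a^2].  For [s >= 1],
the bound of [based_sc_descent] is the model for [s = 1] with a nonpositive
linear term added, and the model increases with [s]. *)
Lemma curvature_progress x s v : dom f x -> 0 < s -> unit_min_eigenvector f x v ->
  ~~ newton_case f F eH x s v -> arm_progress x s v.
Proof.
move=> fx s0 [v1 vE] nc.
pose d := arm_dir f F eH x s v.
have dE : d = if dotc (grad f x) v <= 0 then v else - v.
  by rewrite /d /arm_dir (negbTE nc).
have dv A : quad A d = quad A v by rewrite dE; case: ifP; rewrite ?quadN.
have dg : dotc (grad f x) d <= 0.
  by rewrite dE; case: (leP (dotc (grad f x) v) 0) => // /ltW; rewrite dotcNr oppr_le0.
have d0 : d != 0.
  by rewrite dE; case: ifP; rewrite ?oppr_eq0 (enorm1_neq0 v1).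
pose del := quad (hess f x) d; pose Del := quad (hess F x) d.
have deltaE : arm_delta f F eH x s v = del := erefl.
have DeltaE : arm_Delta f F eH x s v = Del := erefl.
have Del0 : 0 <= Del := quad_hessF_ge0 d (fF fx).
have delE : del = lambda_min (hess f x).
  by rewrite /del dv; exact: quad_eigen v1 vE.
have DelE : Del = quad (hess F x) v := dv _.
have q0 : 0 < del + Del := quad_sum_gt0 fx d0.
have descent t : 0 <= t -> k * Num.sqrt (del + Del) * t < 1 ->
    dom f (x + t *: d) /\
    fine (f (x + t *: d)) <= fine (f x) + t * dotc (grad f x) d +
      curvature_gap kF k (Num.sqrt Del) (Num.sqrt (del + Del)) t :=
  based_sc_descent fx d0.
have modelE t (q : R) : q = del + s * Del -> 0 <= q -> _ :=
  curvature_modelE t fx nc.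
rewrite {}DeltaE in modelE.
have stepE : arm_steplength f F k kF eH x s v =
    if 0 < del + s * Del then argmin0 (arm_model f F k kF eH x s v) else 0.
  by rewrite /arm_steplength deltaE.
(* The Hessian forms are hidden from here on: only scalar facts about
[del] and [Del] matter. *)
clearbody del Del.
have sDel0 : 0 <= s * Del by rewrite mulr_ge0// ltW.
have c0 : 0 < Num.sqrt eH by rewrite sqrtr_gt0.
have curv : del < - (Num.sqrt eH * (s * Del)).
  move: nc; rewrite /newton_case -ltNge /lambda_nc -DelE -delE.
  by rewrite mulrAC mulrC.
have del0 : del < 0.
  by apply: (lt_le_trans curv); rewrite oppr_le0 mulr_ge0// ltW.
pose Q := del + s * Del.
have DsD : 1 <= s -> Del <= s * Del by move=> s1; rewrite ler_peMl.
have H1 : 1 <= s -> 0 < Q by move=> /DsD; rewrite /Q; lra.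
have [Q0|Q0] := leP Q 0.
  left; split; first by rewrite stepE ltNge Q0.
  by rewrite ltNge; apply/negP => /H1; rewrite ltNge Q0.
pose a := Num.sqrt (s * Del); pose b := Num.sqrt Q.
have a2 : a ^+ 2 = s * Del by exact: sqr_sqrtr.
have b2 : b ^+ 2 = Q by rewrite sqr_sqrtr// ltW.
have b0 : 0 < b by rewrite sqrtr_gt0.
have {}sDel0 : 0 < s * Del by move: Q0; rewrite /Q; lra.
have ba : b < a by rewrite ltr_sqrt// /Q; lra.
have bab : 0 < b < a by rewrite b0.
have a0 : 0 < a by apply: lt_trans ba.
pose t := curvature_step kF k a b.
have t0 : 0 <= t by apply/ltW; exact: curvature_step_gt0.
have kbt : k * b * t < 1 by exact: curvature_step_lt.
have mE u := modelE u Q erefl (ltW Q0).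
have tE : arm_steplength f F k kF eH x s v = t.
  rewrite stepE Q0.
  apply: (@argmin0_gap _ _ (curvature_gap kF k a b) (fine (f x)) (k * b)) => //.
  by move=> u u0 ku ut; exact: curvature_gap_min.
right; exists (- curvature_gap kF k a b t).
have dec : curvature_gap kF k a b t <=
    - (Num.sqrt eH ^+ 3 / (12 * (kF + 2 * k) ^+ 2)).
  by apply: curvature_gap_le => //; rewrite a2 b2 /Q; lra.
have eH0 : 0 < Num.sqrt eH ^+ 3 / (12 * (kF + 2 * k) ^+ 2).
  by rewrite divr_gt0 ?exprn_gt0// mulr_gt0// exprn_gt0// addr_gt0// mulr_gt0.
split; [lra| |by rewrite tE mE kbt opprK|].
  by rewrite /arm_gain ge_min; apply/orP; right; lra.
move=> s1; rewrite /arm_trial tE -/d opprK.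
have {}DsD := DsD s1; pose q := del + Del.
have qb : Num.sqrt q <= b by rewrite ler_wsqrtr// lerD2l.
have Da : Num.sqrt Del <= a by rewrite ler_wsqrtr.
have kq : k * Num.sqrt q * t <= k * b * t.
  by rewrite ler_wpM2r// ler_pM2l.
have [ft b1] := descent t t0 (le_lt_trans kq kbt).
split=> //; apply: (le_trans b1); apply: lerD.
  by rewrite gerDl mulr_ge0_le0.
apply: curvature_gap_le_gap => //; rewrite ?sqrtr_ge0 ?Da ?qb//.
by rewrite a2 b2 !sqr_sqrtr ?(ltW q0)// /Q /q; lra.
Qed.

Lemma arm_iteration_progress x s v : dom f x -> 0 < s ->
  unit_min_eigenvector f x v -> ~ arm_stop f F eg eH x s v -> arm_progress x s v.
Proof.
move=> fx s0 vE ns; have [nc|nc] := boolP (newton_case f F eH x s v).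
  apply: newton_progress => //; rewrite ltNge; apply/negP => nueg.
  exact: ns.
exact: curvature_progress.
Qed.

Lemma arm_ratio_ge1 x s v : dom f x -> 1 <= s -> arm_progress x s v ->
  (1 <= arm_ratio f F k kF eH x s v)%E.
Proof.
move=> fx s1 [[_]|[D [D0 _ mD /(_ s1)[fxt ftD]]]]; first by rewrite ltNge s1.
rewrite /arm_ratio mD (domE f_proper fx) (domE f_proper fxt) -!EFinB.
rewrite /= subKr inver gt_eqF// -EFinM lee_fin ler_pdivlMr//.
lra.
Qed.

Lemma arm_next_decrease x s v (e : R) : dom f x -> 0 < e -> arm_progress x s v ->
  (e%:E < arm_ratio f F k kF eH x s v)%E ->
  dom f (arm_trial f F k kF eH x s v) /\
  fine (f (arm_trial f F k kF eH x s v)) <=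
  fine (f x) - e * arm_gain.
Proof.
move=> fx e0 [[st _]|[D [D0 cD mD _]]].
  by rewrite arm_ratio_zero_step// lte_fin ltNge ltW.
rewrite /arm_ratio mD (domE f_proper fx) -!EFinB.
rewrite /= subKr inver gt_eqF//.
have [ft|] := boolP `[< dom f (arm_trial f F k kF eH x s v) >].
  move/asboolP: ft => ft; rewrite (domE f_proper ft) -EFinB -EFinM lte_fin.
  rewrite ltr_pdivlMr// => H; split=> //.
  have : e * arm_gain <= e * D by rewrite ler_pM2l.
  by rewrite /=; lra.
move=> /asboolP/negP; rewrite /dom /= -leNgt leye_eq => /eqP ->.
by rewrite /= mulNyr gtr0_sg ?invr_gt0// mul1e.
Qed.

(** sigma grows only when [r < eta2], hence only when it is below 1, and then by a
factor [gamma3] at most. *)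
Lemma sigma_next_bounds s s' r : 0 < s ->
  arm_sigma_update p r s s' -> (1 <= s -> (1 <= r)%E) ->
  [/\ 0 < s', s' <= Num.max s (gamma3 p),
      ((eta1 p)%:E < r)%E -> gamma1 p * s <= s' &
      (r <= (eta1 p)%:E)%E -> gamma2 p * s <= s'].
Proof.
move=> s0 [up mid dn] r1.
have [/andP[sm0 _] [e10 /andP[e12 e21]] [/andP[g10 g11] /andP[g21 g32]]] := p_ok.
have [er|re] := leP (eta2 p)%:E r.
  have /andP[] := up er; rewrite ge_max => /andP[sms gs] ss.
  split=> //; first exact: lt_le_trans sms.
  - by rewrite le_max ss.
  - by move=> /dn/andP[].
have s1 : s < 1.
  rewrite ltNge; apply/negP => /r1 r1'.
  by move: (le_lt_trans r1' re); rewrite lte_fin; lra.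
have [er|re'] := ltP (eta1 p)%:E r.
  have /andP[ss sg] : s <= s' <= gamma2 p * s by apply: mid; rewrite er.
  split=> //; [exact: lt_le_trans ss| | ].
  - rewrite le_max; apply/orP; right; apply: (le_trans sg).
    have : gamma2 p * s <= gamma2 p * 1 by rewrite ler_pM2l; lra.
    lra.
  - by move=> _; apply: le_trans ss; rewrite ger_pMl// ltW.
have /andP[gs sg] := dn re'.
split.
- by apply: lt_le_trans gs; rewrite mulr_gt0//; lra.
- rewrite le_max; apply/orP; right; apply: (le_trans sg).
  by rewrite ger_pMr; lra.
- by [].
- by [].
Qed.

Section run.
Variables (x0 : 'cV[R]_n) (xs vs : nat -> 'cV[R]_n) (ss : nat -> R).
Hypotheses (x0_dom : dom f x0) (run : arm_run f F k kF p eg eH x0 xs ss vs).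

Lemma arm_run_step j : arm_reached f F eg eH xs ss vs j ->
  dom f (xs j) -> 0 < ss j -> ~ arm_stop f F eg eH (xs j) (ss j) (vs j) ->
  [/\ dom f (xs j.+1), 0 < ss j.+1, ss j.+1 <= Num.max (ss j) (gamma3 p) &
   (fine (f (xs j.+1)) <= fine (f (xs j)) - eta1 p * arm_gain /\
    gamma1 p * ss j <= ss j.+1) \/
   (fine (f (xs j.+1)) <= fine (f (xs j)) /\ gamma2 p * ss j <= ss j.+1)].
Proof.
move=> rj fx s0 ns; have [_ _ /(_ j rj)[vE /(_ ns)[xE sE]]] := run.
have e10 : 0 < eta1 p by case: p_ok => _ [].
have P := arm_iteration_progress fx s0 vE ns.
have R1 : 1 <= ss j -> (1 <= arm_ratio f F k kF eH (xs j) (ss j) (vs j))%E.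
  by move=> s1; exact: arm_ratio_ge1.
have [s0' sle g1 g2] := sigma_next_bounds s0 sE R1.
have [er|re] := ltP (eta1 p)%:E (arm_ratio f F k kF eH (xs j) (ss j) (vs j)).
  have [ft dec] := arm_next_decrease fx e10 P er.
  rewrite xE /arm_next er; split=> //; left; split=> //; exact: g1.
rewrite xE /arm_next ltNge re /=; split=> //; right; split=> //; exact: g2.
Qed.

Lemma arm_run_invariant j : arm_reached f F eg eH xs ss vs j ->
  [/\ dom f (xs j), 0 < ss j & ss j <= Num.max (sigma0 p) (gamma3 p)].
Proof.
have [xs0 ss0 _] := run.
elim: j => [_|j IH rj].
  rewrite xs0 ss0; split=> //; last by rewrite le_max lexx.
  by case: p_ok => /andP[sm0 sm] _ _; exact: lt_le_trans sm.
have rj' : arm_reached f F eg eH xs ss vs j.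
  by move=> i ij; apply: rj; exact: ltnW.
have [fx s0 sM] := IH rj'.
have [fx' s0' sM' _] := arm_run_step rj' fx s0 (rj _ (ltnSn j)).
split=> //; apply: (le_trans sM'); rewrite ge_max sM /=.
by rewrite le_max lexx orbT.
Qed.

(** The weight of a success in the potential: undoing the decrease of sigma by the
factor [gamma1] takes [ln (1 / gamma1) / ln gamma2] failures, plus 1 for the
success itself. *)
Definition failures_per_success := 1 + ln (gamma1 p)^-1 / ln (gamma2 p).

(** The right-hand side bounds the potential
[ln (sigma / sigma0) / ln gamma2] plus the weighted number of gains
[eta1 * arm_gain] in the decrease of [f] so far; each iteration raises it by at
least 1. *)
Lemma arm_reached_bound j (b : R) : (forall x, (b%:E <= f x)%E) ->
  arm_reached f F eg eH xs ss vs j ->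
  j%:R <= ln (Num.max (sigma0 p) (gamma3 p) / sigma0 p) / ln (gamma2 p) +
    failures_per_success * ((fine (f x0) - b) / (eta1 p * arm_gain)).
Proof.
move=> fb rj.
have [/andP[sm0 sms] [e10 _] [/andP[g10 g11] /andP[g21 g32]]] := p_ok.
have sig0 : 0 < sigma0 p by exact: lt_le_trans sms.
have lg2 : 0 < ln (gamma2 p) by rewrite ln_gt0.
have lg1 : 0 <= ln (gamma1 p)^-1 by rewrite ln_ge0// invf_ge1// ltW.
have K1 : 1 <= failures_per_success by rewrite lerDl divr_ge0// ltW.
have gain0 : 0 < arm_gain.
  rewrite lt_min; apply/andP; split.
    by rewrite divr_gt0 ?exprn_gt0// mulr_gt0// addr_gt0// mulr_gt0.
  rewrite divr_gt0 ?exprn_gt0 ?sqrtr_gt0// mulr_gt0// exprn_gt0//.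
  by rewrite addr_gt0// mulr_gt0.
have eg0 : 0 < eta1 p * arm_gain by rewrite mulr_gt0.
have [xs0 ss0 _] := run.
have pot i : (i <= j)%N -> i%:R <= ln (ss i / sigma0 p) / ln (gamma2 p) +
    failures_per_success *
      ((fine (f x0) - fine (f (xs i))) / (eta1 p * arm_gain)).
  elim: i => [_|i IH ij].
    by rewrite xs0 ss0 divff ?gt_eqF// ln1 mul0r subrr mul0r mulr0 addr0.
  have ri : arm_reached f F eg eH xs ss vs i.
    by move=> l li; apply: rj; exact: ltn_trans ij.
  have [fx s0 _] := arm_run_invariant ri.
  have [_ s0' _ step] := arm_run_step ri fx s0 (rj _ ij).
  have {}IH := IH (ltnW ij); rewrite -natr1.
  move: IH step; rewrite !ln_div ?posrE//.
  set fi := fine (f (xs i)); set fi' := fine (f (xs i.+1)).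
  move=> IH; rewrite /failures_per_success in K1 IH *.
  set K := 1 + _ in K1 IH *.
  have lnle (c : R) : 0 < c -> c * ss i <= ss i.+1 ->
      ln c + ln (ss i) <= ln (ss i.+1).
    by move=> c0 cs; rewrite -lnM ?posrE// ler_ln ?posrE// mulr_gt0.
  case=> -[df /lnle ds]; apply: (le_trans (lerD IH (lexx 1))).
    have {}ds := ds g10.
    have d1 : (ln (ss i) - ln (sigma0 p)) / ln (gamma2 p) <=
      (ln (ss i.+1) - ln (sigma0 p)) / ln (gamma2 p) + (K - 1).
      rewrite /K [_ - 1]addrC addKr -mulrDl ler_pM2r ?invr_gt0// lnV ?posrE//.
      by lra.
    have d2 : (fine (f x0) - fi) / (eta1 p * arm_gain) + 1 <=
              (fine (f x0) - fi') / (eta1 p * arm_gain).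
      rewrite -[X in _ + X](divff (lt0r_neq0 eg0)) -mulrDl.
      by rewrite ler_pM2r ?invr_gt0//; lra.
    have := ler_wpM2l (le_trans ler01 K1) d2; rewrite mulrDr mulr1; lra.
  have {}ds := ds (lt_trans ltr01 g21).
  have d1 : (ln (ss i) - ln (sigma0 p)) / ln (gamma2 p) + 1 <=
      (ln (ss i.+1) - ln (sigma0 p)) / ln (gamma2 p).
    rewrite -[X in _ + X](divff (lt0r_neq0 lg2)) -mulrDl.
    by rewrite ler_pM2r ?invr_gt0//; lra.
  have d2 : (fine (f x0) - fi) / (eta1 p * arm_gain) <=
            (fine (f x0) - fi') / (eta1 p * arm_gain).
    by rewrite ler_pM2r ?invr_gt0//; lra.
  have := ler_wpM2l (le_trans ler01 K1) d2; lra.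
have [fx s0 sM] := arm_run_invariant rj.
apply: (le_trans (pot j (leqnn j))); apply: lerD.
  rewrite ler_pM2r ?invr_gt0// ler_ln ?posrE ?divr_gt0 ?ler_pM2r ?invr_gt0//.
  exact: lt_le_trans sM.
rewrite ler_wpM2l ?(le_trans ler01 K1)// ler_pM2r ?invr_gt0//.
rewrite lerD2l lerN2 -lee_fin -domE//; exact: fb.
Qed.

End run.

End iteration.

(** * The iteration bound *)

Theorem theorem3p7 (R : realType) (n : nat) (f F : 'cV[R]_n -> \bar R)
    (k kF : R) (p : arm_params R) (x0 : 'cV[R]_n)
    (f_proper : forall x, f x <> -oo%E)
    (F_proper : forall x, F x <> -oo%E)
    (k_gt0 : 0 < k) (kF_gt0 : 0 < kF)
    (f_C3 : Ck_dom 3 f)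
    (f_bounded_below : exists b : R, forall x, (b%:E <= f x)%E)
    (f_sc : based_self_concordant F k f)
    (F_strict : strictly_convex F)
    (F_sc : self_concordant kF F)
    (p_ok : arm_params_ok p)
    (x0_dom : dom f x0) :
  (forall eg eH : R, 0 < eg -> 0 < eH ->
     forall (xs vs : nat -> 'cV[R]_n) (ss : nat -> R),
       arm_run f F k kF p eg eH x0 xs ss vs ->
       forall j, arm_reached f F eg eH xs ss vs j ->
         ss j <= Num.max (sigma0 p) (gamma3 p)) /\
  (exists C e0 : R, 0 < e0 /\
     forall eg eH : R, 0 < eg < e0 -> 0 < eH < e0 ->
     forall (xs vs : nat -> 'cV[R]_n) (ss : nat -> R),
       arm_run f F k kF p eg eH x0 xs ss vs ->
       exists J : nat,
         [/\ arm_reached f F eg eH xs ss vs J,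
             arm_stop f F eg eH (xs J) (ss J) (vs J) &
             J.+1%:R <= C * (eg ^- 2 + eH `^ (- (3 / 2)))]).
Proof.
split.
  move=> eg eH eg0 eH0 xs vs ss run j rj.
  by have [] := arm_run_invariant f_proper F_proper k_gt0 kF_gt0 f_C3 f_sc
    F_strict F_sc eg0 eH0 p_ok x0_dom run rj.
have [b fb] := f_bounded_below.
have [/andP[sm0 sms] [e10 _] [/andP[g10 g11] /andP[g21 g32]]] := p_ok.
have sig0 : 0 < sigma0 p by exact: lt_le_trans sms.
pose A := ln (Num.max (sigma0 p) (gamma3 p) / sigma0 p) / ln (gamma2 p).
pose B := failures_per_success p * ((fine (f x0) - b) / eta1 p).
have A0 : 0 <= A.
  rewrite divr_ge0 ?ln_ge0//; last exact: ltW.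
  by rewrite ler_pdivlMr// mul1r le_max lexx.
have B0 : 0 <= B.
  rewrite mulr_ge0//.
    by rewrite addr_ge0// divr_ge0 ?ln_ge0 ?invf_ge1 ?(ltW g11) ?(ltW g21).
  rewrite divr_ge0 ?(ltW e10)// subr_ge0 -lee_fin -domE//; exact: fb.
pose c1 := 2 * (1 + k); pose c2 := 12 * (kF + 2 * k) ^+ 2.
have c10 : 0 < c1 by rewrite /c1; lra.
have c20 : 0 < c2 by rewrite mulr_gt0// exprn_gt0//; lra.
exists (A + 2 + B * (c1 + c2)), 1; split=> // eg eH /andP[eg0 eg1] /andP[eH0 eH1].
move=> xs vs ss run.
pose G := arm_gain k kF eg eH.
pose S := eg ^- 2 + eH `^ (- (3 / 2)).
have eHE : eH `^ (- (3 / 2)) = (Num.sqrt eH ^+ 3)^-1.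
  by rewrite powRN powR_3half// ltW.
have sH0 : 0 < Num.sqrt eH ^+ 3 by rewrite exprn_gt0// sqrtr_gt0.
have eg20 : 0 < eg ^- 2 by rewrite invr_gt0 exprn_gt0.
have sH1 : 1 <= eH `^ (- (3 / 2)).
  rewrite eHE invf_ge1// exprn_ile1 ?sqrtr_ge0//.
  by rewrite -[leRHS]sqrtr1 ler_wsqrtr// ltW.
have S1 : 1 <= S by rewrite /S; lra.
have G0 : 0 < G.
  rewrite lt_min; apply/andP; split; last by rewrite divr_gt0.
  by rewrite divr_gt0 ?exprn_gt0// mulr_gt0// addr_gt0// mulr_gt0.
(* A minimum of two gains has an inverse bounded by the sum of the inverses. *)
have GS : G^-1 <= (c1 + c2) * S.
  have sH0' : 0 < eH `^ (- (3 / 2)) by apply: lt_le_trans sH1.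
  have c1S : c1 * eg ^- 2 <= (c1 + c2) * S.
    apply: ler_pM; rewrite ?(ltW c10) ?(ltW eg20)//.
      by rewrite lerDl ltW.
    by rewrite lerDl ltW.
  have c2S : c2 * eH `^ (- (3 / 2)) <= (c1 + c2) * S.
    apply: ler_pM; rewrite ?(ltW c20) ?(ltW sH0')//.
      by rewrite lerDr ltW.
    by rewrite lerDr ltW.
  rewrite /G /arm_gain minEle; case: ifP => _.
    apply: le_trans c1S; rewrite invf_div ler_pM2r//.
    rewrite /c1 ler_pM2l// lerD2l -[leRHS]mulr1 ler_pM2l//; exact: ltW.
  by apply: le_trans c2S; rewrite invf_div eHE.
have bound j : arm_reached f F eg eH xs ss vs j ->
    j%:R <= A + B * ((c1 + c2) * S).
  move=> rj.
  have := arm_reached_bound f_proper F_proper k_gt0 kF_gt0 f_C3 f_sc F_strict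
    F_sc eg0 eH0 p_ok x0_dom run fb rj.
  have -> : failures_per_success p *
      ((fine (f x0) - b) / (eta1 p * arm_gain k kF eg eH)) = B * G^-1.
    by rewrite /B /G invfM !mulrA.
  by move=> /le_trans; apply; rewrite lerD2l ler_wpM2l.
have [J stopJ minJ] : exists2 J, arm_stop f F eg eH (xs J) (ss J) (vs J) &
    arm_reached f F eg eH xs ss vs J.
  pose P := [pred j | `[< arm_stop f F eg eH (xs j) (ss j) (vs j) >]].
  have exP : exists j, P j.
    apply: contrapT => nP.
    pose m := (Num.truncn (A + B * ((c1 + c2) * S))).+1.
    have /bound : arm_reached f F eg eH xs ss vs m.
      by move=> i _ si; apply: nP; exists i; apply/asboolP.
    rewrite leNgt truncnS_gt//.
  have [J PJ mJ] := ex_minnP exP.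
  exists J; first exact/asboolP.
  by move=> i iJ si; move: (mJ i); rewrite leqNgt iJ; move/(_ (asboolT si)).
exists J; split=> //; rewrite -natr1 -/S.
have := bound J minJ.
have : A + 2 <= (A + 2) * S by rewrite ler_peMr//; lra.
have -> : (A + 2 + B * (c1 + c2)) * S = (A + 2) * S + B * ((c1 + c2) * S).
  by ring.
lra.
Qed.
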